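(* Let $\{X_t\}$ be an irreducible Markov chain on a finite state space $\Sigma$, let $i,j\in\Sigma$ with $j\ne i$, $\epsilon,\alpha\in(0,1)$, and run the multiple-state version of $\mathrm{IteratedRefinement}(i,\epsilon,\alpha)$ with anchor state $i$ and with $j$ among the observer states. With probability greater than $1-\alpha$, for all iterations $k$, $$\left|\tilde\pi_j^{(k)}-\pi_j\right|\le2(1+\epsilon)\,\mathbb P_i\big(T_i>\theta^{(k)}\big)Z_{\max}(j)\,\hat\pi_i^{(k)}+\epsilon\tilde\pi_j^{(k)}+\epsilon\le4(1+\epsilon)\,2^{-\theta^{(k)}/(2H_i)}Z_{\max}(j)\,\hat\pi_i^{(k)}+\epsilon\tilde\pi_j^{(k)}+\epsilon.$$
   Context: Chain: $\{X_t\}_{t\ge0}$ is a discrete-time Markov chain with transition matrix $P$ and unique stationary distribution $\pi$; $\mathbb P_i(\cdot)=\mathbb P(\cdot\mid X_0=i)$, $\mathbb E_i[\cdot]=\mathbb E[\cdot\mid X_0=i]$; $T_i=\inf\{t\ge1:X_t=i\}$. Mixing quantities (finite $\Sigma$): $H_i=\max_{j\in\Sigma}\mathbb E_j[T_i]$; the fundamental matrix is $Z=(I-P+\mathbf 1\pi^T)^{-1}$, also written $Z=\sum_{t\ge0}(P^t-\mathbf 1\pi^T)$; $Z_{\max}(j)=\max_{k\in\Sigma}|Z_{kj}|$. Algorithm (multiple-state $\mathrm{IteratedRefinement}(i,\epsilon,\alpha)$): iterations $k=1,2,\dots$ with truncation thresholds $\theta^{(k)}=2^k$ and sample sizes $N^{(1)}=\lceil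 6(1+\epsilon)\ln(8/\alpha)/\epsilon^2\rceil$, $N^{(k+1)}=\lceil 3(1+\epsilon)\theta^{(k+1)}\ln(4\theta^{(k+1)}/\alpha)/(\hat T_i^{(k)}\epsilon^2)\rceil$. In iteration $k$, $N^{(k)}$ fresh independent realizations of the chain started at $X_0=i$ are simulated, each stopped at the first time $t\ge1$ with $t=\theta^{(k)}$ or $X_t=i$; the $s$-th has length $t_s$ distributed as $\min(T_i,\theta^{(k)})$. Set $\hat T_i^{(k)}=\frac1{N^{(k)}}\sum_{s=1}^{N^{(k)}}t_s$ and $\hat\pi_i^{(k)}=1/\hat T_i^{(k)}$. For the observer state $j$, let $f_s(j)=\sum_{r=1}^{\theta^{(k)}}\mathbb 1\{X_r=j\}\mathbb 1\{r\le T_i\}$ be the number of visits to $j$ along the $s$-th sample path, $\hat F_j^{(k)}=\frac1{N^{(k)}}\sum_{s=1}^{N^{(k)}}f_s(j)$ and $\tilde\pi_j^{(k)}=\hat F_j^{(k)}/\hat T_i^{(k)}$. *)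

(* Defs.v *)
From HB Require Import structures.
From mathcomp Require Import all_boot all_order all_algebra.
From mathcomp Require Import all_classical all_reals all_analysis.

Set Implicit Arguments.
Unset Strict Implicit.
Unset Printing Implicit Defensive.

Import Order.TTheory GRing.Theory Num.Theory.
Import numFieldNormedType.Exports.

Local Open Scope classical_set_scope.
Local Open Scope ring_scope.

Section TransitionMatrix.
Variables (R : realType) (S : finType).
Implicit Types (P : S -> S -> R) (pi : S -> R).

Definition stochastic P :=
  (forall x y, 0 <= P x y) /\ (forall x, \sum_y P x y = 1).

(* The state space is an arbitrary finite type; 'M_#|S| is indexed through
   enum_val / enum_rank so that powers and inverses are the library's. *)
Definition transition_mx P : 'M[R]_#|S| :=
  \matrix_(a, b) P (enum_val a) (enum_val b).

Definition irreducible P :=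
  forall x y, exists n,
    0 < (transition_mx P ^+ n) (enum_rank x) (enum_rank y).

Definition stationary P pi :=
  [/\ forall x, 0 <= pi x, \sum_x pi x = 1 &
      forall y, \sum_x pi x * P x y = pi y].

(* Z = (I - P + 1 pi^T)^-1.  The matrix is invertible for every irreducible P,
   periodic or not, so invmx is a genuine inverse there. *)
Definition fundamental_mx P pi : 'M[R]_#|S| :=
  invmx (1%:M - transition_mx P
         + (const_mx 1 : 'cV_#|S|) *m (\row_b pi (enum_val b))).

Definition Zmax P pi (j : S) : R :=
  \big[Num.max/0]_(k : S) `|fundamental_mx P pi (enum_rank k) (enum_rank j)|.

End TransitionMatrix.

Section Processes.
Variables (R : realType) (S : finType) (d : measure_display)
  (W : measurableType d).

(* X is a Markov chain with transition matrix P started at i, under Q.  The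
   Markov property is written multiplicatively, so that histories of
   probability zero need no separate treatment. *)
Definition markov_chain_from (Q : probability W R) (P : S -> S -> R) (i : S)
    (X : nat -> W -> S) :=
  [/\ forall t x, measurable (X t @^-1` [set x]),
      Q (X 0%N @^-1` [set i]) = 1%E &
      forall n (x : nat -> S),
        Q [set w | forall t, (t <= n.+1)%N -> X t w = x t] =
        (Q [set w | forall t, (t <= n)%N -> X t w = x t]
         * (P (x n) (x n.+1))%:E)%E].

Definition process_sigma (X : nat -> W -> S) : set (set W) :=
  <<s [set A | exists t x, A = X t @^-1` [set x]] >>.

Definition mutually_independent (Q : probability W R) (I : eqType)
    (F : I -> set (set W)) :=
  forall (l : seq I) (A : I -> set W), uniq l ->
    (forall a, a \in l -> F a (A a)) ->
    Q (\bigcap_(a in [set` l]) A a) = (\prod_(a <- l) Q (A a))%E.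

End Processes.

Section HittingTime.
Variables (R : realType) (S : finType).

(* T_i = inf {t >= 1 : x_t = i} along a path x, equal to +oo if x never
   visits i after time 0. *)
Definition hitting_time (i : S) (x : nat -> S) : \bar R :=
  ereal_inf [set (t%:R)%:E | t in [set t : nat | (1 <= t)%N /\ x t = i]].

Variables (d : measure_display) (W : measurableType d)
  (Pr : S -> probability W R) (X : nat -> W -> S).

(* Pr x is the law P_x of the chain started at x. *)
Definition expected_hitting_time (x i : S) : \bar R :=
  (\int[Pr x]_w hitting_time i (X ^~ w))%E.

(* H_i = max_x E_x[T_i]; it is finite for an irreducible chain, so that fine
   is harmless. *)
Definition max_hitting_time (i : S) : R :=
  fine (\big[maxe/-oo%E]_(x : S) expected_hitting_time x i).

Definition tail_prob (i : S) (m : nat) : R :=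
  fine (Pr i [set w | ((m%:R)%:E < hitting_time i (X ^~ w))%E]).

End HittingTime.

Section Algorithm.
Variables (R : realType) (S : finType).

Definition threshold (k : nat) : nat := (2 ^ k)%N.

Definition sample_length (i : S) (theta : nat) (x : nat -> S) : R :=
  fine (mine (hitting_time R i x) (theta%:R)%:E).

Definition sample_visits (i j : S) (theta : nat) (x : nat -> S) : R :=
  \sum_(1 <= r < theta.+1)
    (x r == j)%:R * (((r%:R)%:E <= hitting_time R i x)%E)%:R.

Definition sample_mean (N : nat) (v : nat -> R) : R :=
  (\sum_(s < N) v s) / N%:R.

Definition nat_ceil (a : R) : nat := `|Num.ceil a|%N.

Variables (i : S) (eps alpha : R).

(* y k s is the s-th path (s = 0, 1, ...) available to iteration k; iteration
   k >= 1 uses the first N^(k) of them.  The value at k = 0 is a dummy. *)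
Variable y : nat -> nat -> nat -> S.

Fixpoint sample_size (k : nat) : nat :=
  match k with
  | 0%N => 0%N
  | k'.+1 =>
    if k' == 0%N then nat_ceil (6 * (1 + eps) * ln (8 / alpha) / eps ^+ 2)
    else
      let That := sample_mean (sample_size k')
                    (fun s => sample_length i (threshold k') (y k' s)) in
      let theta : R := (threshold k)%:R in
      nat_ceil (3 * (1 + eps) * theta * ln (4 * theta / alpha)
                / (That * eps ^+ 2))
  end.

Definition T_hat (k : nat) : R :=
  sample_mean (sample_size k)
    (fun s => sample_length i (threshold k) (y k s)).

Definition pi_hat (k : nat) : R := (T_hat k)^-1.

Definition F_hat (j : S) (k : nat) : R :=
  sample_mean (sample_size k)
    (fun s => sample_visits i j (threshold k) (y k s)).

Definition pi_tilde (j : S) (k : nat) : R := F_hat j k / T_hat k.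

End Algorithm.

(* Main.v *)
(* Let T_k and F_k be the means of the truncated return time and of the number
   of visits to j in iteration k.  With g = P Z e_j, Poisson's equation and optional
   stopping at min(T_i, theta) give
     F_k - pi_j T_k = E_i[(g(i) - g(X_theta)) 1{T_i > theta}],
   so |F_k - pi_j T_k| <= 2 P_i(T_i > theta) Zmax(j).  If the sample means of
   iteration k are both within eps T_k of T_k and F_k, the first inequality
   follows by elementary algebra.  If iteration k - 1 is accurate, the sample size of
   iteration k is large enough for a Chernoff bound to make each of the four
   one-sided deviations have probability at most alpha / (4 theta); summing over the
   first failing iteration gives less than alpha.  Sample sizes are bounded by a
   constant for each k, so the data of the first k iterations live in a finite
   product space, where the random sample size is independent of the fresh samples.
   The tail P_i(T_i > theta) is bounded by Markov's inequality over blocks of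
   length floor(2 H_i). *)

Require Import Defs.
From HB Require Import structures.
From mathcomp Require Import all_boot all_order all_algebra.
From mathcomp Require Import all_classical all_reals all_analysis.
From mathcomp Require Import measurable_realfun ring lra.

Set Implicit Arguments.
Unset Strict Implicit.
Unset Printing Implicit Defensive.

Import Order.TTheory GRing.Theory Num.Theory.
Import numFieldNormedType.Exports.

Local Open Scope classical_set_scope.
Local Open Scope ring_scope.

(** * Product laws and the Chernoff bound *)

Section ProductLaw.
Variables (R : realType) (I T : finType) (p : T -> R).
Hypotheses (p_ge0 : forall t, 0 <= p t) (p_sum1 : \sum_t p t = 1).

(** Expectation under independent coordinates of law [p]. Being a finite sum, it keeps the
    independence and Chernoff arguments algebraic; [config_event] links it to the probability of the
    samples. *)
Definition product_mean (g : {ffun I -> T} -> R) : R :=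
  \sum_(F : {ffun I -> T}) (\prod_a p (F a)) * g F.

Lemma product_law_ge0 (F : {ffun I -> T}) : 0 <= \prod_a p (F a).
Proof. exact: prodr_ge0. Qed.

Lemma product_mean_prod (phi : I -> T -> R) :
  product_mean (fun F => \prod_a phi a (F a)) =
  \prod_a \sum_t p t * phi a t.
Proof.
rewrite bigA_distr_bigA /product_mean /=.
by apply: eq_bigr => F _; rewrite big_split.
Qed.

Lemma product_mean_cst c : product_mean (fun=> c) = c.
Proof.
rewrite /product_mean -mulr_suml.
have -> : \sum_(F : {ffun I -> T}) \prod_a p (F a) = 1.
  rewrite -(bigA_distr_bigA (fun (_ : I) t => p t)) /=.
  by rewrite big1 // => a _.
by rewrite mul1r.
Qed.

Lemma product_mean_sum (J : finType) (g : J -> {ffun I -> T} -> R) :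
  product_mean (fun F => \sum_b g b F) = \sum_b product_mean (g b).
Proof.
rewrite exchange_big /=; apply: eq_bigr => F _.
by rewrite big_distrr.
Qed.

Lemma product_meanZ c g :
  product_mean (fun F => c * g F) = c * product_mean g.
Proof.
by rewrite /product_mean mulr_sumr; apply: eq_bigr => F _; rewrite mulrCA.
Qed.

Lemma le_product_mean g h : (forall F, g F <= h F) ->
  product_mean g <= product_mean h.
Proof.
by move=> gh; apply: ler_sum => F _; rewrite ler_wpM2l ?product_law_ge0.
Qed.

Lemma product_mean_ge0 g : (forall F, 0 <= g F) -> 0 <= product_mean g.
Proof. by move=> g0; apply: sumr_ge0 => F _; rewrite mulr_ge0 ?product_law_ge0. Qed.

(* Exchanging the A-coordinates of two independent copies of the configuration
   is a weight-preserving involution; it turns E[h]E[g] into E[hg]E[1]. *)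
Lemma product_mean_indep (A : pred I) (h g : {ffun I -> T} -> R) :
  (forall F G : {ffun I -> T}, (forall a, A a -> F a = G a) -> h F = h G) ->
  (forall F G : {ffun I -> T}, (forall a, ~~ A a -> F a = G a) -> g F = g G) ->
  product_mean (fun F => h F * g F) = product_mean h * product_mean g.
Proof.
move=> hA gA.
pose mix (FG : {ffun I -> T} * {ffun I -> T}) : {ffun I -> T} :=
  [ffun a => if A a then FG.1 a else FG.2 a].
pose sw FG := (mix FG, mix (FG.2, FG.1)).
have swK : involutive sw.
  move=> [F G]; rewrite /sw /mix /=; congr pair;
    by apply/ffunP => a; rewrite !ffunE /=; case: ifP; rewrite ?ffunE => ->.
pose w (FG : {ffun I -> T} * {ffun I -> T}) := (\prod_a p (FG.1 a)) * \prod_a p (FG.2 a).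
have wsw FG : w (sw FG) = w FG.
  rewrite /w /= -!big_split /=; apply: eq_bigr => a _.
  by rewrite !ffunE /=; case: ifP => // _; rewrite mulrC.
have -> : product_mean h * product_mean g = \sum_FG w FG * (h FG.1 * g FG.2).
  rewrite big_distrlr pair_big /=; apply: eq_bigr => -[F G] _.
  by rewrite /w /=; ring.
rewrite (reindex_inj (inv_inj swK)) /=.
rewrite -[LHS]mulr1 -(product_mean_cst 1) big_distrlr pair_big /=.
apply: eq_bigr => -[F G] _; rewrite wsw /w /= mulr1.
rewrite (hA (mix _) F) ?(gA (mix _) F); first by ring.
  by move=> a /negbTE Aa; rewrite !ffunE Aa.
by move=> a Aa; rewrite !ffunE Aa.
Qed.

End ProductLaw.

Section Chernoff.
Variable R : realType.
Implicit Types x u eps : R.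

(** Convexity of the exponential: in the average of the tangent inequalities from [x * u] to 0 and
    to [x], with weights [1 - u] and [u], the linear terms cancel. *)
Lemma expR_interp x u : 0 <= u <= 1 -> expR (x * u) <= 1 + u * (expR x - 1).
Proof.
case/andP=> u0 u1; set m := x * u.
have tangent y : expR m * (1 + (y - m)) <= expR y.
  have -> : expR y = expR m * expR (y - m) by rewrite -expRD addrC subrK.
  by rewrite ler_pM2l ?expR_gt0 ?expR_ge1Dx.
have t0 := tangent 0; have tx := tangent x; rewrite expR0 in t0.
have : (1 - u) * (expR m * (1 + (0 - m))) + u * (expR m * (1 + (x - m))) <=
  (1 - u) * 1 + u * expR x by rewrite lerD// ler_wpM2l// subr_ge0.
by rewrite /m; lra.
Qed.

(* The bound holds because (1 + x + 3/4 x^2) e^-x has derivative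
   x (1/2 - 3/4 x) e^-x, hence a global minimum 1 at 0 on ]-oo, 2/3]. *)
Lemma expR_le_quadratic x : x <= 2 / 3 -> expR x <= 1 + x + 3 / 4 * x ^+ 2.
Proof.
move=> x23.
pose h := fun x : R => (1 + x + 3 / 4 * x ^+ 2) * expR (- x).
have dh (y : R) : is_derive y 1 h (y * (1 / 2 - 3 / 4 * y) * expR (- y)).
  apply: is_derive_eq.
  rewrite /GRing.scale /=.
  by set e := expR _; lra.
have dvh (y : R) : derivable h y 1 by exact: ex_derive.
have ch (y : R) : {for y, continuous h}.
  by apply: differentiable_continuous; apply/derivable1_diffP.
have h'E (y : R) : h^`()%classic y = y * (1 / 2 - 3 / 4 * y) * expR (- y).
  by rewrite derive1E; apply: derive_val.
have h0 : h 0 = 1 by rewrite /h oppr0 expR0; lra.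
have h1 : 1 <= h x.
  rewrite -h0; case: (leP 0 x) => x0.
    apply: (@ger0_derive1_ndecr R h 0 (2 / 3)) => // [y|].
      rewrite in_itv/= => /andP[y0 y1]; rewrite h'E mulr_ge0 ?expR_ge0//.
      by rewrite mulr_ge0//; lra.
    by apply: continuous_subspaceT.
  apply: (@ler0_derive1_nincrNy R h 0) => // [y||]; last exact: ltW.
    rewrite in_itv/= => y0; rewrite h'E pmulr_lle0 ?expR_gt0//.
    by rewrite mulr_le0_ge0//; lra.
  by apply: continuous_subspaceT.
by move: h1; rewrite /h expRN ler_pdivlMr ?expR_gt0// mul1r.
Qed.

(* [|x| = 2/3 eps] minimises [3/4 x^2 - eps |x|], with minimum [- eps^2 / 3]. *)
Lemma chernoff_exponent (mu T eps x : R) : 0 <= mu -> mu <= T ->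
  0 <= eps -> eps <= 1 -> `|x| = 2 / 3 * eps ->
  mu * (expR x - 1 - x) - `|x| * (eps * T) <= - (eps ^+ 2 * T / 3).
Proof.
move=> mu0 muT e0 e1 xE.
have x23 : x <= 2 / 3 by apply: le_trans (ler_norm x) _; rewrite xE; lra.
have x2 : x ^+ 2 = (2 / 3 * eps) ^+ 2 by rewrite -xE real_normK ?num_real.
have hq : expR x - 1 - x <= eps ^+ 2 / 3.
  by have := expR_le_quadratic x23; rewrite x2; lra.
have e2 : 0 <= eps ^+ 2 / 3 by rewrite divr_ge0 ?sqr_ge0.
have : mu * (expR x - 1 - x) <= T * (eps ^+ 2 / 3).
  apply: le_trans (ler_wpM2l mu0 hq) _; exact: ler_wpM2r.
by rewrite xE; nra.
Qed.

(* The sign of [x] selects the tail: positive for the upper one, negative for the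
   lower one. *)
Lemma chernoff_one_sided (I T : finType) (p : T -> R) (v : T -> R)
    (B : {set I}) (theta tau eps x : R) :
  (forall t, 0 <= p t) -> \sum_t p t = 1 ->
  0 < theta -> (forall t, 0 <= v t <= theta) ->
  let mu := \sum_t p t * v t in
  mu <= tau -> 0 <= eps -> eps <= 1 -> `|x| = 2 / 3 * eps ->
  product_mean p (fun F : {ffun I -> T} =>
    ((#|B|%:R * (`|x| * (eps * tau)) <=
      x * (\sum_(a in B) v (F a) - #|B|%:R * mu))%R)%:R) <=
  expR (- (#|B|%:R * eps ^+ 2 * tau / (3 * theta))).
Proof.
move=> p0 p1 th0 vth mu mutau e0 e1 xE.
set n : R := #|B|%:R.
have mu0 : 0 <= mu.
  by apply: sumr_ge0 => t _; rewrite mulr_ge0//; case/andP: (vth t).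
(* Exponential Markov inequality: [c] gathers the deterministic factors of exp ((x (s - n mu) - n
   |x| eps tau) / theta), where s is the sum over [B]. Coordinates outside [B] contribute a factor
   1. *)
pose c := expR (- (n * (mu * x + `|x| * (eps * tau)) / theta)).
pose phi (a : I) t := if a \in B then expR (x * (v t / theta)) else 1.
have markov (F : {ffun I -> T}) :
    ((n * (`|x| * (eps * tau)) <= x * (\sum_(a in B) v (F a) - n * mu))%R)%:R
    <= c * \prod_a phi a (F a).
  rewrite /nat_of_bool; case: ifPn => [ge|_] /=; last first.
    rewrite mulr_ge0 ?expR_ge0// prodr_ge0// => a _; rewrite /phi.
    by case: ifP; rewrite ?expR_ge0.
  rewrite /phi -big_mkcond /= -expR_sum -expRD -expR0 ler_expR.
  rewrite -mulr_sumr -mulr_suml addrC subr_ge0.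
  rewrite mulrA ler_pM2r ?invr_gt0//; lra.
apply: le_trans (le_product_mean p0 markov) _.
rewrite product_meanZ product_mean_prod.
(* Division by [theta] brings [v] into [0, 1], so the chord bound applies to each factor; then 1 + z
   <= exp z. *)
have fac a : 0 <= \sum_t p t * phi a t <=
    if a \in B then expR (mu / theta * (expR x - 1)) else 1.
  rewrite /phi; case: ifP => aB; last first.
    by under eq_bigr do rewrite mulr1; rewrite p1 ler01 lexx.
  apply/andP; split; first by apply: sumr_ge0 => t _; rewrite mulr_ge0 ?expR_ge0.
  apply: le_trans (expR_ge1Dx _).
  have -> : 1 + mu / theta * (expR x - 1) =
      \sum_t p t * (1 + v t / theta * (expR x - 1)).
    under eq_bigr do rewrite mulrDr mulr1 mulrA mulrA.
    by rewrite big_split/= p1 /mu mulr_suml mulr_suml.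
  apply: ler_sum => t _; apply: ler_wpM2l => //; apply: expR_interp.
  case/andP: (vth t) => v0 v1.
  by rewrite divr_ge0 ?(ltW th0)//= ler_pdivrMr// mul1r.
have : \prod_a \sum_t p t * phi a t <=
    \prod_a (if a \in B then expR (mu / theta * (expR x - 1)) else 1).
  by apply: ler_prod => a _; exact: fac.
rewrite -big_mkcond prodr_const -expRM_natl => fac_le.
apply: le_trans (ler_wpM2l (expR_ge0 _) fac_le) _.
rewrite -expRD ler_expR.
have -> : - (n * (mu * x + `|x| * (eps * tau)) / theta) +
   n * (mu / theta * (expR x - 1)) =
   n / theta * (mu * (expR x - 1 - x) - `|x| * (eps * tau)) by ring.
have -> : - (n * eps ^+ 2 * tau / (3 * theta)) =
   n / theta * (- (eps ^+ 2 * tau / 3)) by field; exact: lt0r_neq0.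
apply: ler_wpM2l; first by rewrite divr_ge0 ?ler0n// ltW.
exact: chernoff_exponent.
Qed.

End Chernoff.

(** * Poisson's equation *)

Section FundamentalMatrix.
Variables (R : realType) (S : finType) (P : S -> S -> R) (pi : S -> R).
Hypotheses (Pstoch : stochastic P) (Pirr : irreducible P)
  (pistat : stationary P pi).

Lemma sum_enum_val (f : S -> R) : \sum_(b < #|S|) f (enum_val b) = \sum_y f y.
Proof. by rewrite [RHS](big_enum_val (A := predT)). Qed.

Lemma transition_mx_pow_ge0 n a b : 0 <= (transition_mx P ^+ n) a b.
Proof.
elim: n a b => [|n IHn] a b; first by rewrite expr0 !mxE ler0n.
rewrite exprS mxE sumr_ge0// => c _; rewrite mulr_ge0 ?mxE//.
by case: Pstoch.
Qed.

Lemma harmonic_pow (v : 'cV[R]_#|S|) n :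
  transition_mx P *m v = v -> transition_mx P ^+ n *m v = v.
Proof.
move=> Pv; elim: n => [|n IHn]; first by rewrite expr0 mul1mx.
by rewrite exprS -mulmxA IHn.
Qed.

Lemma transition_mx_const : transition_mx P *m const_mx 1 = const_mx 1 :> 'cV_#|S|.
Proof.
apply/matrixP => a b; rewrite !mxE.
under eq_bigr do rewrite !mxE mulr1.
by rewrite (sum_enum_val (P (enum_val a))); case: Pstoch.
Qed.

(* Maximum principle: at a maximum point a0 of v, the mean of v under each row
   P^n(a0, .) equals the maximum. *)
Lemma harmonic_const (v : 'cV[R]_#|S|) : transition_mx P *m v = v ->
  forall a b, v a 0 = v b 0.
Proof.
move=> Pv.
suff [m vm] : exists m, forall a, v a 0 = m by move=> a b; rewrite !vm.
have [a1|nS] := pickP 'I_#|S|; last by exists 0 => a; have := nS a.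
have [a0 _ a0max] := @arg_maxP _ _ _ a1 predT (fun a => v a 0) isT.
exists (v a0 0) => a.
have [n] := Pirr (enum_val a0) (enum_val a); rewrite !enum_valK => Pn_gt0.
have : \sum_b (transition_mx P ^+ n) a0 b * (v a0 0 - v b 0) = 0.
  under eq_bigr do rewrite mulrBr.
  rewrite sumrB -mulr_suml.
  have -> : \sum_b (transition_mx P ^+ n) a0 b = 1.
    have := congr1 (fun w : 'cV_#|S| => w a0 0) (harmonic_pow n transition_mx_const).
    by rewrite !mxE => <-; apply: eq_bigr => b _; rewrite mxE mulr1.
  rewrite mul1r; have := congr1 (fun w : 'cV_#|S| => w a0 0) (harmonic_pow n Pv).
  by rewrite mxE => ->; rewrite subrr.
move=> /eqP; rewrite psumr_eq0; last first.
  move=> b _; rewrite mulr_ge0 ?transition_mx_pow_ge0// subr_ge0.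
  exact: a0max.
move=> /allP /(_ a (mem_index_enum a)) /=; rewrite mulf_eq0 gt_eqF//= subr_eq0.
by move=> /eqP.
Qed.

Let E : 'cV[R]_#|S| := const_mx 1.
Let p : 'rV[R]_#|S| := \row_b pi (enum_val b).

Lemma stationary_mx : p *m transition_mx P = p.
Proof.
apply/matrixP => a b; rewrite !mxE; case: pistat => _ _ <-.
by rewrite -sum_enum_val; apply: eq_bigr => c _; rewrite !mxE.
Qed.

Lemma stationary_mx_sum : p *m E = 1%:M.
Proof.
apply/matrixP => a b; rewrite !ord1 !mxE; case: pistat => _ <- _.
by rewrite -sum_enum_val; apply: eq_bigr => c _; rewrite !mxE mulr1.
Qed.

(** [pi] is a left fixed vector of the matrix to be inverted. This forces [pi v = 0] for kernel
    vectors [v] and later gives [pi Z = pi]. *)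
Lemma stationary_mx_kernel_inv : p *m (1%:M - transition_mx P + E *m p) = p.
Proof.
by rewrite mulmxDr mulmxBr mulmx1 stationary_mx subrr add0r mulmxA
  stationary_mx_sum mul1mx.
Qed.

(** A kernel vector is annihilated by [pi], hence harmonic, hence constant by the maximum principle;
    its constant value is its [pi]-mean, which is 0. *)
Lemma fundamental_unitmx : 1%:M - transition_mx P + E *m p \in unitmx.
Proof.
(* Transposing turns kernel vectors into columns, on which harmonicity is stated. *)
rewrite -unitmx_tr -row_free_unit; apply: inj_row_free => u uA.
pose v := u^T.
have Av : (1%:M - transition_mx P + E *m p) *m v = 0.
  by apply: trmx_inj; rewrite trmx_mul trmxK uA trmx0.
have pv : p *m v = 0 by rewrite -stationary_mx_kernel_inv -mulmxA Av mulmx0.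
have Pv : transition_mx P *m v = v.
  move: Av; rewrite mulmxDl mulmxBl mul1mx -mulmxA pv mulmx0 addr0.
  by move=> /eqP; rewrite subr_eq0 => /eqP.
apply/rowP => a; rewrite [RHS]mxE.
have -> : u 0 a = v a 0 by rewrite mxE.
have := congr1 (fun w : 'M[R]_1 => w 0 0) pv; rewrite mxE [RHS]mxE.
under eq_bigr => b _ do rewrite (harmonic_const Pv b a).
rewrite -mulr_suml.
have -> : \sum_b p 0 b = 1; last by rewrite mul1r.
case: pistat => _ <- _; rewrite -sum_enum_val.
by apply: eq_bigr => b _; rewrite mxE.
Qed.

Definition fundamental (x y : S) : R :=
  fundamental_mx P pi (enum_rank x) (enum_rank y).

(** With A the inverted matrix, A Z = I and [pi Z = pi] give (I - P) Z = I - 1 pi, which is read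
    entrywise. *)
Lemma poisson_equation x y :
  fundamental x y - \sum_z P x z * fundamental z y = (x == y)%:R - pi y.
Proof.
have AZ := mulmxV fundamental_unitmx.
have pZ : p *m fundamental_mx P pi = p.
  by rewrite -[in LHS]stationary_mx_kernel_inv -mulmxA AZ mulmx1.
have : (1%:M - transition_mx P) *m fundamental_mx P pi = 1%:M - E *m p.
  by rewrite -[in LHS](addrK (E *m p) (_ - _)) mulmxBl AZ -mulmxA pZ.
move=> /(congr1 (fun w : 'M[R]_#|S| => w (enum_rank x) (enum_rank y))).
rewrite mulmxBl mul1mx !mxE big_ord1 !mxE mul1r enum_rankK.
rewrite (inj_eq enum_rank_inj) => <-; congr (_ - _).
rewrite -sum_enum_val; apply: eq_bigr => c _.
by rewrite !mxE enum_rankK /fundamental enum_valK.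
Qed.

Lemma fundamental_le_Zmax x y : `|fundamental x y| <= Zmax P pi y.
Proof. exact: (le_bigmax_cond 0 (fun k => `|fundamental k y|)). Qed.

Lemma Zmax_ge0 y : 0 <= Zmax P pi y.
Proof. exact: bigmax_ge_id. Qed.

End FundamentalMatrix.

(** * Hitting times and laws of finite paths *)

Section Paths.
Variables (R : realType) (S : finType).
Implicit Types (i j : S) (x : nat -> S).

(** The event T_i > m as a boolean of the path. Time 0 is left out because the sampled paths start
    at [i] itself. *)
Definition avoids i (m : nat) x : bool := all (fun t => x t != i) (iota 1 m).

Lemma avoidsS i m x : avoids i m.+1 x = avoids i m x && (x m.+1 != i).
Proof. by rewrite /avoids -[m.+1]addn1 iotaD all_cat /= andbT add1n addn1. Qed.

Lemma avoidsP i m x :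
  reflect (forall t, (1 <= t <= m)%N -> x t != i) (avoids i m x).
Proof.
apply: (iffP allP) => h t.
  by move=> ht; apply: h; rewrite mem_iota add1n ltnS.
by rewrite mem_iota add1n ltnS; exact: h.
Qed.

Lemma eq_avoids i m x x' :
  (forall t, (t <= m)%N -> x t = x' t) -> avoids i m x = avoids i m x'.
Proof.
move=> xx'; apply: eq_in_all => t; rewrite mem_iota add1n ltnS => /andP[_ tm].
by rewrite xx'.
Qed.

(** T_i takes integer values or +oo, so T_i >= m + 1 and T_i > m are the same event. *)
Lemma hitting_time_ge i m x :
  ((m.+1%:R)%:E <= hitting_time R i x)%E = avoids i m x.
Proof.
apply/idP/avoidsP => [h t /andP[t1 tm]|h].
  apply/eqP => xt.
  have : (hitting_time R i x <= (t%:R)%:E)%E by apply: ereal_inf_lbound; exists t.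
  move=> /(le_trans h); rewrite lee_fin ler_nat => mt.
  by have := leq_ltn_trans tm mt; rewrite ltnn.
apply: le_ereal_inf_tmp => _ [t [t1 xt] <-]; rewrite lee_fin ler_nat ltnNge.
by apply/negP => tm; have := h t; rewrite t1 tm xt eqxx => /(_ isT).
Qed.

Lemma hitting_time_gt i m x :
  ((m%:R)%:E < hitting_time R i x)%E = avoids i m x.
Proof.
apply/idP/idP => [h|]; last first.
  by rewrite -hitting_time_ge; apply: lt_le_trans; rewrite lte_fin ltr_nat.
apply/avoidsP => t /andP[t1 tm]; apply/eqP => xt.
have : (hitting_time R i x <= (t%:R)%:E)%E by apply: ereal_inf_lbound; exists t.
by move=> /(lt_le_trans h); rewrite lte_fin ltr_nat ltnNge tm.
Qed.

Lemma hitting_time_ge1 i x : (1%:E <= hitting_time R i x)%E.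
Proof. by rewrite (hitting_time_ge i 0). Qed.

(** Layer-cake formula: min(T_i, theta) counts the r < theta with T_i > r. Means of truncated return
    times thus become sums of survival probabilities. *)
Lemma min_hitting_timeE i theta x :
  mine (hitting_time R i x) (theta%:R)%:E =
  (\sum_(r < theta) (avoids i r x)%:R)%:E.
Proof.
elim: theta => [|n IHn].
  by rewrite big_ord0 min_r// (le_trans _ (hitting_time_ge1 i x))// lee_fin.
rewrite big_ord_recr/= EFinD -IHn; case: (boolP (avoids i n x)) => h.
  rewrite min_r ?hitting_time_ge// min_r ?ltW ?hitting_time_gt//.
  by rewrite -EFinD natr1.
have hn : (hitting_time R i x <= (n%:R)%:E)%E by rewrite leNgt hitting_time_gt.
rewrite adde0 min_l// ?min_l//.
by rewrite (le_trans hn)// lee_fin ler_nat.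
Qed.

Lemma sample_lengthE i theta x :
  sample_length R i theta x = \sum_(r < theta) (avoids i r x)%:R.
Proof. by rewrite /sample_length min_hitting_timeE. Qed.

(** The index is shifted: a visit at time r + 1 counts when [i] is avoided through time r, so time
    T_i itself is included. *)
Lemma sample_visitsE i j theta x :
  sample_visits R i j theta x =
  \sum_(r < theta) (avoids i r x && (x r.+1 == j))%:R.
Proof.
rewrite /sample_visits big_add1 /= big_mkord; apply: eq_bigr => r _.
by rewrite hitting_time_ge; case: avoids; case: eqP; rewrite ?mulr1 ?mulr0.
Qed.

Lemma sample_visits_ge0 i j theta x : 0 <= sample_visits R i j theta x.
Proof. by rewrite sample_visitsE sumr_ge0. Qed.

Lemma sample_visits_le_length i j theta x :
  sample_visits R i j theta x <= sample_length R i theta x.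
Proof.
rewrite sample_visitsE sample_lengthE; apply: ler_sum => r _.
by rewrite ler_nat; case: avoids; case: eqP.
Qed.

Lemma sample_length_le i theta x : sample_length R i theta x <= theta%:R.
Proof.
rewrite sample_lengthE -[theta in leRHS]card_ord -sumr_const.
by apply: ler_sum => r _; rewrite lern1 leq_b1.
Qed.

Lemma sample_length_ge1 i theta x : (0 < theta)%N ->
  1 <= sample_length R i theta x.
Proof.
case: theta => // theta _.
by rewrite sample_lengthE big_ord_recl lerDl sumr_ge0.
Qed.

Lemma eq_sample_length i theta x x' : (forall t, (t <= theta)%N -> x t = x' t) ->
  sample_length R i theta x = sample_length R i theta x'.
Proof.
move=> xx'; rewrite !sample_lengthE; apply: eq_bigr => r _.
rewrite (eq_avoids i (x' := x'))// => t tr.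
by rewrite xx'// (leq_trans tr)// ltnW.
Qed.

Lemma eq_sample_visits i j theta x x' : (forall t, (t <= theta)%N -> x t = x' t) ->
  sample_visits R i j theta x = sample_visits R i j theta x'.
Proof.
move=> xx'; rewrite !sample_visitsE; apply: eq_bigr => r _.
rewrite xx'// (eq_avoids i (x' := x'))// => t tr.
by rewrite xx'// (leq_trans tr)// ltnW.
Qed.

End Paths.

Section FiniteValued.
Variables (R : realType) (d : measure_display) (W : measurableType d)
  (Q : probability W R) (T : finType) (f : W -> T).
Hypothesis mf : forall t, measurable (f @^-1` [set t]).

Lemma measurable_finite_valued (B : set T) : measurable (f @^-1` B).
Proof.
have -> : f @^-1` B = \bigcup_(t in B) (f @^-1` [set t]).
  by apply/seteqP; split=> [w Bw|w [t Bt] /= ->//]; exists (f w).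
exact: fin_bigcup_measurable.
Qed.

Lemma measure_finite_valued (B : pred T) :
  Q [set w | B (f w)] = (\sum_(t | B t) Q (f @^-1` [set t]))%E.
Proof.
have -> : [set w | B (f w)] = \bigcup_(t in [set` enum B]) (f @^-1` [set t]).
  apply/seteqP; split=> [w Bw|w [t]/=].
    by exists (f w) => //=; rewrite mem_enum.
  by rewrite mem_enum => Bt ->.
rewrite measure_fin_bigcup//=; last first.
  apply/trivIsetP => s t _ _ /eqP st; apply/seteqP; split=> // w /= [fs ft].
  by case: st; move: fs ft; rewrite /preimage /= => <- <-.
by rewrite -fsbig_seq ?enum_uniq// big_enum.
Qed.

End FiniteValued.

(** * Path weights and the chain killed at a state *)

Section PathLaw.
Variables (R : realType) (S : finType) (P : S -> S -> R).
Hypothesis Pstoch : stochastic P.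

Definition path_of n (x : nat -> S) : {ffun 'I_n.+1 -> S} := [ffun t : 'I_n.+1 => x t].
(** Lets functionals of infinite paths be applied to finite ones. After time [n] the value is the
    arbitrary [f ord0], so only times up to [n] carry meaning. *)
Definition path_ext n (f : {ffun 'I_n.+1 -> S}) : nat -> S := fun t => f (inord t).

Lemma path_ofK n x t : (t <= n)%N -> path_ext (path_of n x) t = x t.
Proof. by move=> tn; rewrite /path_ext ffunE inordK. Qed.

Lemma path_extK n (f : {ffun 'I_n.+1 -> S}) : path_of n (path_ext f) = f.
Proof. by apply/ffunP => t; rewrite ffunE /path_ext inord_val. Qed.

Definition path_law (x0 : S) n (f : {ffun 'I_n.+1 -> S}) : R :=
  (path_ext f 0 == x0)%:R * \prod_(t < n) P (path_ext f t) (path_ext f t.+1).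

Lemma path_law_ge0 x0 n (f : {ffun 'I_n.+1 -> S}) : 0 <= path_law x0 f.
Proof. by rewrite mulr_ge0// prodr_ge0// => t _; case: Pstoch. Qed.

(* [taboo i x m y] is the probability that the chain started at x avoids i at
   times 1, ..., m and is at y at time m. *)
Fixpoint taboo (i x : S) (m : nat) (y : S) : R :=
  match m with
  | 0%N => (x == y)%:R
  | m'.+1 => if y == i then 0 else \sum_z taboo i x m' z * P z y
  end.

Lemma taboo_ge0 i x m y : 0 <= taboo i x m y.
Proof.
case: Pstoch => P0 _; elim: m y => [|m IHm] y /=; first by rewrite ler0n.
by case: ifP => // _; rewrite sumr_ge0// => z _; rewrite mulr_ge0.
Qed.

(** Chapman-Kolmogorov equation for the chain killed on its visits to [i] after time 0. *)
Lemma tabooD i x m n y :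
  taboo i x (m + n) y = \sum_z taboo i x m z * taboo i z n y.
Proof.
elim: n y => [|n IHn] y.
  rewrite addn0 (bigD1 y)//= eqxx mulr1 big1 ?addr0// => z /negbTE ->.
  by rewrite mulr0.
rewrite addnS /=; case: ifP => _; first by rewrite big1// => z _; rewrite mulr0.
under eq_bigr do rewrite IHn mulr_suml.
rewrite exchange_big; apply: eq_bigr => z _; rewrite mulr_sumr.
by apply: eq_bigr => u _; rewrite mulrA.
Qed.

Definition survival (i x : S) (m : nat) : R := \sum_y taboo i x m y.

Lemma survival_ge0 i x m : 0 <= survival i x m.
Proof. by apply: sumr_ge0 => y _; exact: taboo_ge0. Qed.

Lemma survival0 i x : survival i x 0 = 1.
Proof.
rewrite /survival (bigD1 x)//= eqxx big1 ?addr0// => y.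
by rewrite eq_sym => /negbTE ->.
Qed.

Lemma survivalD_le i x m n c : (forall y, survival i y n <= c) ->
  survival i x (m + n) <= survival i x m * c.
Proof.
move=> hc; rewrite /survival.
under eq_bigr do rewrite tabooD.
rewrite exchange_big mulr_suml /=; apply: ler_sum => z _.
by rewrite -mulr_sumr ler_wpM2l ?taboo_ge0// hc.
Qed.

(** The mass lost in one step is the mass that moves into [i]; both sides are the probability that
    T_i = m + 1. *)
Lemma survivalS i x m :
  survival i x m - survival i x m.+1 = \sum_z taboo i x m z * P z i.
Proof.
case: Pstoch => _ P1.
have -> : survival i x m = \sum_y \sum_z taboo i x m z * P z y.
  rewrite exchange_big; apply: eq_bigr => z _.
  by rewrite -mulr_sumr P1 mulr1.
rewrite /survival -sumrB (bigD1 i)//= eqxx subr0.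
by rewrite [X in _ + X]big1 ?addr0// => y /negbTE ->; rewrite subrr.
Qed.

Lemma survival_nincr i x m n : (m <= n)%N -> survival i x n <= survival i x m.
Proof.
move=> /subnK <-; elim: (n - m)%N => [|k IHk] //.
apply: le_trans IHk; rewrite addSn -subr_ge0 survivalS sumr_ge0// => z _.
by rewrite mulr_ge0 ?taboo_ge0//; case: Pstoch.
Qed.

Lemma survival_le1 i x m : survival i x m <= 1.
Proof. by rewrite -(survival0 i x) survival_nincr. Qed.

Lemma survival_pow i x m q c : 0 <= c -> (forall y, survival i y m <= c) ->
  survival i x (q * m) <= c ^+ q.
Proof.
move=> c0 hc; elim: q => [|q IHq]; first by rewrite mul0n survival0.
rewrite mulSn addnC exprSr.
by apply: le_trans (survivalD_le _ _ hc) _; exact: ler_wpM2r.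
Qed.

End PathLaw.

(** * Finite-dimensional laws of a Markov chain *)

Section ChainPaths.
Variables (R : realType) (S : finType) (P : S -> S -> R) (x0 : S).
Variables (d : measure_display) (W : measurableType d) (Q : probability W R)
  (X : nat -> W -> S).
Hypothesis (Xchain : markov_chain_from Q P x0 X).

Lemma measurable_path n f :
  measurable ((fun w => path_of n (X ^~ w)) @^-1` [set f]).
Proof.
have [mX _ _] := Xchain.
have -> : (fun w => path_of n (X ^~ w)) @^-1` [set f] =
    \bigcap_(t in [set` 'I_n.+1]) (X t @^-1` [set f t]).
  apply/seteqP; split=> [w <- t _ /=|w h /=]; first by rewrite ffunE.
  by apply/ffunP => t; rewrite ffunE; exact: h.
by apply: fin_bigcap_measurable => // t _; exact: mX.
Qed.

Lemma path_probability n f :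
  Q ((fun w => path_of n (X ^~ w)) @^-1` [set f]) = (path_law P x0 f)%:E.
Proof.
have [mX Q0 Qstep] := Xchain.
have -> : (fun w => path_of n (X ^~ w)) @^-1` [set f] =
    [set w | forall t, (t <= n)%N -> X t w = path_ext f t].
  apply/seteqP; split=> [w <- t tn|w h /=]; first by rewrite path_ofK.
  by apply/ffunP => t; rewrite ffunE (h t (leq_ord t)) /path_ext inord_val.
rewrite /path_law; move: (path_ext f) => x {f}.
elim: n => [|n IHn]; last by rewrite Qstep IHn -EFinM big_ord_recr/= mulrA.
have -> : [set w | forall t, (t <= 0)%N -> X t w = x t] = X 0%N @^-1` [set x 0%N].
  apply/seteqP; split=> [w /(_ 0%N isT)//|w h t].
  by rewrite leqn0 => /eqP ->.
rewrite big_ord0 mulr1; have [->|/eqP ne] := eqVneq (x 0%N) x0; first exact: Q0.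
(* A path with another initial state lies in the complement of an event of probability 1. *)
suff : (Q (X 0%N @^-1` [set x 0%N]) <= 0)%E by rewrite measure_le0 => /eqP.
have -> : 0%E = (1 - Q (X 0%N @^-1` [set x0]))%E by rewrite Q0 subee.
rewrite -probability_setC//; apply: le_measure; rewrite ?inE//.
  exact: measurableC.
by move=> w /= -> /ne.
Qed.

Lemma path_event n (B : pred {ffun 'I_n.+1 -> S}) :
  Q [set w | B (path_of n (X ^~ w))] = (\sum_(f | B f) path_law P x0 f)%:E.
Proof.
rewrite (measure_finite_valued Q (@measurable_path n)) -sumEFin.
by apply: eq_bigr => f _; exact: path_probability.
Qed.

Lemma path_law_sum1 n : \sum_(f : {ffun 'I_n.+1 -> S}) path_law P x0 f = 1.
Proof.
apply: EFin_inj; rewrite -(path_event (n := n) predT).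
by rewrite -[RHS](probability_setT Q); congr (Q _); apply/seteqP; split.
Qed.

(** The Markov property for an arbitrary event [B] of the past, obtained from the one for single
    histories. *)
Lemma path_step n (B : pred {ffun 'I_n.+1 -> S}) y :
  Q [set w | B (path_of n (X ^~ w)) && (X n.+1 w == y)] =
  (\sum_z (\sum_(f | B f && (path_ext f n == z)) path_law P x0 f) * P z y)%:E.
Proof.
have [mX _ _] := Xchain.
pose Bn (f : {ffun 'I_n.+2 -> S}) := B (path_of n (path_ext f)) && (path_ext f n.+1 == y).
have -> : [set w | B (path_of n (X ^~ w)) && (X n.+1 w == y)] =
    [set w | Bn (path_of n.+1 (X ^~ w))].
  rewrite /Bn; apply: eq_set => w; rewrite path_ofK//.
  suff <- : path_of n (X ^~ w) = path_of n (path_ext (path_of n.+1 (X ^~ w))) by [].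
  by apply/ffunP => t; rewrite !ffunE path_ofK// ltnW.
rewrite path_event; congr EFin.
(* Appending [y] is a bijection onto the paths that end in [y], with truncation as inverse; it
   multiplies the weight by one transition probability. *)
pose snoc (f : {ffun 'I_n.+1 -> S}) : {ffun 'I_n.+2 -> S} :=
  path_of n.+1 (fun t => if (t <= n)%N then path_ext f t else y).
have snocE f t : (t <= n)%N -> path_ext (snoc f) t = path_ext f t.
  by move=> tn; rewrite path_ofK ?tn// ltnW.
have snocy f : path_ext (snoc f) n.+1 = y by rewrite path_ofK// ltnn.
under [RHS]eq_bigr do rewrite mulr_suml.
have -> : \sum_z \sum_(f | B f && (path_ext f n == z)) path_law P x0 f * P z y =
    \sum_(f | B f) path_law P x0 f * P (path_ext f n) y.
  rewrite (partition_big (fun f => path_ext f n) predT)//=.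
  by apply: eq_bigr => z _; apply: eq_bigr => f /andP[_ /eqP ->].
rewrite (reindex_onto snoc (fun f => path_of n (path_ext f))) /=.
  apply: eq_big => [f|f _].
    rewrite /Bn snocy eqxx andbT.
    suff -> : path_of n (path_ext (snoc f)) = f by rewrite eqxx andbT.
    rewrite -[RHS]path_extK; apply/ffunP => t.
    by rewrite !ffunE snocE// -ltnS.
  rewrite /path_law big_ord_recr /= snocE// snocE// snocy mulrA.
  congr (_ * _ * _); apply: eq_bigr => t _.
  by rewrite !snocE// ltnW.
move=> f /andP[_ /eqP fy]; rewrite -[RHS]path_extK; apply/ffunP => t.
rewrite !ffunE; case: ifP => tn; first by rewrite path_ofK.
suff -> : (t : nat) = n.+1 by [].
by apply/eqP; rewrite eqn_leq ltnNge tn -ltnS ltn_ord.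
Qed.

(** By induction on [m], [path_step] reproduces the recursion of [taboo]; for [y = i] at a positive
    time the event is empty. *)
Lemma path_avoids_at i m y :
  \sum_(f : {ffun 'I_m.+1 -> S} | avoids i m (path_ext f) && (path_ext f m == y))
    path_law P x0 f = taboo P i x0 m y.
Proof.
elim: m y => [|m IHm] y.
  have [_ Q0 _] := Xchain.
  apply: EFin_inj; rewrite -path_event /=.
  have -> : [set w | path_ext (path_of 0 (X^~ w)) 0 == y] = X 0%N @^-1` [set y].
    by apply/seteqP; split=> w /=; rewrite path_ofK// => /eqP.
  have := path_probability (n := 0) [ffun=> y].
  rewrite /path_law big_ord0 mulr1 /path_ext ffunE eq_sym => <-; congr (Q _).
  apply/seteqP; split=> w /= h.
    by apply/ffunP => t; rewrite !ffunE ord1.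
  by have := congr1 (fun g : {ffun _} => g ord0) h; rewrite !ffunE.
apply: EFin_inj; rewrite -path_event.
have -> : [set w | avoids i m.+1 (path_ext (path_of m.+1 (X^~ w))) &&
     (path_ext (path_of m.+1 (X^~ w)) m.+1 == y)] =
   [set w | ((y != i) && avoids i m (path_ext (path_of m (X ^~ w)))) && (X m.+1 w == y)].
  apply: eq_set => w; rewrite path_ofK// avoidsS path_ofK//.
  rewrite (@eq_avoids _ _ _ (path_ext (path_of m.+1 (X^~ w)))
      (path_ext (path_of m (X ^~ w)))) => [|t tm]; last first.
    by rewrite !path_ofK// (leqW tm).
  by case: (X m.+1 w =P y) => [->|_]; [rewrite !andbT andbC|rewrite !andbF].
rewrite (path_step (fun f => (y != i) && avoids i m (path_ext f)) y) /=.
congr EFin; case: eqP => yi /=.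
  by rewrite big1// => z _; rewrite big1 ?mul0r.
by apply: eq_bigr => z _; rewrite IHm.
Qed.

Lemma path_avoids i m n : (m <= n)%N ->
  \sum_(f : {ffun 'I_n.+1 -> S}) path_law P x0 f * (avoids i m (path_ext f))%:R
  = survival P i x0 m.
Proof.
move=> mn; rewrite /survival; under [RHS]eq_bigr do rewrite -path_avoids_at.
rewrite -(partition_big (fun f => path_ext f m) predT)//=.
rewrite (eq_bigr (fun f => if avoids i m (path_ext f) then path_law P x0 f else 0));
  last by move=> f _; case: ifP; rewrite (mulr1, mulr0).
rewrite -big_mkcond /=; apply: EFin_inj; rewrite -!path_event; congr (Q _).
by apply/seteqP; split=> w /=;
  rewrite (@eq_avoids _ _ _ (path_ext (path_of n (X ^~ w)))
    (path_ext (path_of m (X ^~ w))))// => t tm; rewrite !path_ofK// (leq_trans tm).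
Qed.

Lemma path_avoids_next i m n y : (m < n)%N ->
  \sum_(f : {ffun 'I_n.+1 -> S}) path_law P x0 f *
     (avoids i m (path_ext f) && (path_ext f m.+1 == y))%:R
  = \sum_z taboo P i x0 m z * P z y.
Proof.
move=> mn; under [RHS]eq_bigr do rewrite -path_avoids_at.
apply: EFin_inj; rewrite -(path_step (fun f => avoids i m (path_ext f)) y).
rewrite (eq_bigr (fun f => if avoids i m (path_ext f) && (path_ext f m.+1 == y)
   then path_law P x0 f else 0));
  last by move=> f _; case: ifP; rewrite (mulr1, mulr0).
rewrite -big_mkcond /= -path_event; congr (Q _).
by apply/seteqP; split=> w /=; rewrite path_ofK//;
  rewrite (@eq_avoids _ _ _ (path_ext (path_of n (X ^~ w)))
    (path_ext (path_of m (X ^~ w))))// => t tm; rewrite !path_ofK// (leq_trans tm)// ltnW.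
Qed.

Lemma avoids_probability i m :
  Q [set w | avoids i m (X ^~ w)] = (survival P i x0 m)%:E.
Proof.
rewrite -(path_avoids i (leqnn m)).
rewrite (eq_bigr (fun f => if avoids i m (path_ext f) then path_law P x0 f else 0));
  last by move=> f _; case: ifP; rewrite (mulr1, mulr0).
rewrite -big_mkcond -path_event; congr (Q _).
by apply/seteqP; split=> w /=;
  rewrite (@eq_avoids _ _ _ (path_ext (path_of m (X ^~ w))) (X ^~ w))// => t tm;
  rewrite path_ofK.
Qed.

(** This and [mean_visits] are the expectations of [sample_length] and [sample_visits], written
    through the layer-cake formula; see [path_mean_length] and [path_mean_visits]. *)
Definition mean_length i theta : R := \sum_(r < theta) survival P i x0 r.
Definition mean_visits i j theta : R :=
  \sum_(r < theta) \sum_z taboo P i x0 r z * P z j.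

Lemma path_mean_length i theta :
  \sum_(f : {ffun 'I_theta.+1 -> S})
     path_law P x0 f * sample_length R i theta (path_ext f) = mean_length i theta.
Proof.
under eq_bigr do rewrite sample_lengthE mulr_sumr.
rewrite exchange_big; apply: eq_bigr => r _.
by rewrite path_avoids// ltnW.
Qed.

Lemma path_mean_visits i j theta :
  \sum_(f : {ffun 'I_theta.+1 -> S})
     path_law P x0 f * sample_visits R i j theta (path_ext f) = mean_visits i j theta.
Proof.
under eq_bigr do rewrite sample_visitsE mulr_sumr.
rewrite exchange_big; apply: eq_bigr => r _.
by rewrite path_avoids_next.
Qed.

End ChainPaths.

(** * Bias and tail of the truncated return *)

Section Bias.
Variables (R : realType) (S : finType) (P : S -> S -> R) (pi : S -> R).
Hypotheses (Pstoch : stochastic P) (Pirr : irreducible P)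
  (pistat : stationary P pi).
Variables (i j : S).

(* Optional stopping for the solution [g] of Poisson's equation: visits at times
   1, ..., min(T_i, theta) are counted, so [g] is P Z and not Z. *)
Let g (x : S) : R := \sum_y P x y * fundamental P pi y j.

(** Induction on [theta]: each step adds Poisson's equation weighted by the mass still avoiding [i],
    and the mass that returns contributes [g i]. *)
Lemma visits_optional_stopping theta :
  mean_visits P i i j theta - pi j * mean_length P i i theta =
  g i * survival P i i theta - \sum_y taboo P i i theta y * g y.
Proof.
case: (Pstoch) => P0 P1.
(* Applying P to Poisson's equation for Z gives the one for [g], with source [P z j - pi j]. *)
have poisson z : P z j - pi j = g z - \sum_y P z y * g y.
  have gE y : g y = fundamental P pi y j - ((y == j)%:R - pi j).
    by rewrite -(poisson_equation Pstoch Pirr pistat) /g; ring.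
  under eq_bigr do rewrite gE 2!mulrBr.
  rewrite sumrB sumrB -/(g z) -mulr_suml P1 mul1r (bigD1 j)//= eqxx mulr1.
  by rewrite big1 ?addr0; [ring|move=> y /negbTE ->; rewrite mulr0].
elim: theta => [|n IHn].
  rewrite /mean_visits /mean_length !big_ord0 mulr0 subr0 survival0 mulr1.
  rewrite (bigD1 i)//= eqxx mul1r big1 ?addr0 ?subrr// => y.
  by rewrite eq_sym => /negbTE ->; rewrite mul0r.
rewrite /mean_visits /mean_length !big_ord_recr /=.
rewrite -/(mean_visits P i i j n) -/(mean_length P i i n).
set v := mean_visits _ _ _ _ _; set l := mean_length _ _ _ _.
have step : \sum_z taboo P i i n z * P z j - pi j * survival P i i n =
    \sum_z taboo P i i n z * g z -
    \sum_y (\sum_z taboo P i i n z * P z y) * g y.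
  under [X in _ = _ - X]eq_bigr do rewrite mulr_suml.
  rewrite exchange_big /= /survival mulr_sumr -!sumrB; apply: eq_bigr => z _.
  under [X in _ = _ - X]eq_bigr do rewrite -mulrA.
  by rewrite -mulr_sumr -mulrBr -poisson; ring.
(* The mass entering [i] is split off: it has been stopped and equals the loss of survival
   probability. *)
have split_i : \sum_y (\sum_z taboo P i i n z * P z y) * g y =
    (survival P i i n - survival P i i n.+1) * g i +
    \sum_y taboo P i i n.+1 y * g y.
  rewrite (bigD1 i)//= [in RHS](bigD1 i)//= eqxx mul0r add0r (survivalS Pstoch).
  by congr (_ + _); apply: eq_bigr => y /negbTE ->.
have -> : v + \sum_z taboo P i i n z * P z j - pi j * (l + survival P i i n) =
  (v - pi j * l) + (\sum_z taboo P i i n z * P z j - pi j * survival P i i n).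
  by ring.
rewrite IHn step split_i /=.
set A := \sum_y _ * _; set B := \sum_y _ * _; set s := survival _ _ _ n.+1.
by ring.
Qed.

Lemma visits_bias theta :
  `|mean_visits P i i j theta - pi j * mean_length P i i theta| <=
  2 * survival P i i theta * Zmax P pi j.
Proof.
case: (Pstoch) => P0 P1.
(* [g x] is an average of column [j] of Z along a row of P. *)
have gZ x : `|g x| <= Zmax P pi j.
  apply: le_trans (ler_norm_sum _ _ _) _.
  rewrite -[leRHS]mul1r -(P1 x) mulr_suml; apply: ler_sum => y _.
  by rewrite normrM ger0_norm// ler_wpM2l// fundamental_le_Zmax.
rewrite visits_optional_stopping.
apply: le_trans (ler_normB _ _) _.
rewrite -mulrA mulr_natl mulr2n; apply: lerD.
  by rewrite normrM mulrC ger0_norm ?survival_ge0// ler_wpM2l ?survival_ge0.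
apply: le_trans (ler_norm_sum _ _ _) _; rewrite /survival mulr_suml.
apply: ler_sum => y _.
by rewrite normrM ger0_norm ?taboo_ge0// ler_wpM2l ?taboo_ge0.
Qed.

(** Allows deviations of the visit counts to be measured on the scale of the mean length in the
    Chernoff bound. *)
Lemma mean_visits_le theta : mean_visits P i i j theta <= mean_length P i i theta.
Proof.
case: Pstoch => P0 P1; apply: ler_sum => r _; apply: ler_sum => z _.
rewrite ler_piMr ?taboo_ge0// -(P1 z) (bigD1 j)//= lerDl.
by rewrite sumr_ge0.
Qed.

Lemma mean_length_ge1 theta : (0 < theta)%N -> 1 <= mean_length P i i theta.
Proof.
case: theta => // n _; rewrite /mean_length big_ord_recl survival0 lerDl.
by rewrite sumr_ge0// => r _; exact: survival_ge0.
Qed.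

Lemma mean_length_le m n : (m <= n)%N -> mean_length P i i m <= mean_length P i i n.
Proof.
move=> /subnK <-; elim: (n - m)%N => [|k IHk]//.
apply: le_trans IHk _; rewrite addSn /mean_length big_ord_recr lerDl.
exact: survival_ge0.
Qed.

End Bias.

(* The two one-sided deviations enter with matching signs: dividing the deviation
   of the numerator by that of the denominator leaves exactly a factor 1 +- eps. *)
Lemma ratio_estimate (R : realType) (F Fh T Th pj eps b : R) :
  0 < eps -> eps < 1 -> 0 <= pj -> 0 < Th -> 0 <= Fh ->
  `|Th - T| <= eps * T -> `|Fh - F| <= eps * T ->
  `|F - pj * T| <= 2 * b ->
  `|Fh / Th - pj| <= 2 * (1 + eps) * b * Th^-1 + eps * (Fh / Th) + eps.
Proof.
move=> e0 e1 pj0 Th0 Fh0 /ler_normlP[T1 T2] /ler_normlP[F1 F2] /ler_normlP[b1 b2].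
have b0 : 0 <= b by lra.
have ThN0 : Th != 0 by rewrite gt_eqF.
have -> : 2 * (1 + eps) * b * Th^-1 + eps * (Fh / Th) + eps =
  (2 * (1 + eps) * b + eps * Fh + eps * Th) / Th by field.
have -> : Fh / Th - pj = (Fh - pj * Th) / Th by field.
rewrite normrM [`|Th^-1|]ger0_norm; last by rewrite invr_ge0 ltW.
rewrite ler_pM2r ?invr_gt0//; apply/ler_normlP; split.
  (* Lower deviation. If [pj < eps], the additive term [eps * Th] absorbs it. Otherwise (pj - eps)
     Th <= (pj - eps)(1 + eps) T, and the bounds on [F] and [Fh] are scaled by 1 + eps. *)
  have [pe|pe] := leP eps pj; last first.
    have : 0 <= (eps - pj) * Th by rewrite mulr_ge0// ?ltW// subr_gt0.
    have : 0 <= (1 + eps) * b by rewrite mulr_ge0//; lra.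
    have : 0 <= eps * Fh by rewrite mulr_ge0// ltW.
    lra.
  have : 0 <= (pj - eps) * ((1 + eps) * T - Th) by rewrite mulr_ge0// subr_ge0//; lra.
  have : 0 <= (1 + eps) * (Fh - F + eps * T) by rewrite mulr_ge0//; lra.
  have : 0 <= (1 + eps) * (2 * b - (pj * T - F)) by rewrite mulr_ge0//; lra.
  lra.
(* Upper deviation: (1 - eps) Fh <= (1 - eps)((pj + eps) T + 2 b) <= (pj + eps) Th + 2 (1 - eps)
   b. *)
have : 0 <= (1 - eps) * (F + eps * T - Fh) by rewrite mulr_ge0//; lra.
have : 0 <= (pj + eps) * (Th - (1 - eps) * T) by rewrite mulr_ge0//; lra.
have : 0 <= (1 - eps) * (2 * b - (F - pj * T)) by rewrite mulr_ge0//; lra.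
have : 0 <= eps * b by rewrite mulr_ge0// ltW.
lra.
Qed.

(** * Exponential tail of the return time *)

Section Tail.
Variables (R : realType) (S : finType) (P : S -> S -> R).
Hypotheses (Pstoch : stochastic P).
Variables (d : measure_display) (W : measurableType d)
  (Pr : S -> probability W R) (X : nat -> W -> S).
Hypothesis (Xchain : forall x, markov_chain_from (Pr x) P x X).
Variable i : S.

Lemma tail_probE m : tail_prob Pr X i m = survival P i i m.
Proof.
rewrite /tail_prob.
under eq_set do rewrite hitting_time_gt.
by rewrite (avoids_probability (Xchain i)).
Qed.

Lemma measurable_avoids m : measurable [set w | avoids i m (X ^~ w)].
Proof.
rewrite (_ : [set w | _] =
  (fun w => path_of m (X ^~ w)) @^-1` [set f | avoids i m (path_ext f)]).
  by apply: measurable_finite_valued => f; exact: (measurable_path (Xchain i)).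
apply/eq_set => w /=; congr is_true; apply: eq_avoids => t tm.
by rewrite path_ofK.
Qed.

Lemma measurable_hitting_time :
  measurable_fun setT ((fun w => hitting_time R i (X ^~ w)) : W -> \bar R).
Proof.
move=> mT; apply: (measurability _ (ErealGenOInfty.measurableE R)) => //.
move=> _ [_ [r ->] <-]; rewrite setTI.
(* Since T_i >= 1 is integer-valued, T_i > r always holds for r < 0 and otherwise means T_i >
   floor(r). *)
have [r0|r0] := leP 0 r; last first.
  rewrite (_ : _ @^-1` _ = setT)//; apply/seteqP; split=> // w _ /=.
  by rewrite in_itv/= andbT (lt_le_trans _ (hitting_time_ge1 R i _))// lte_fin; lra.
have /andP[mr rm] := truncn_itv r0.
rewrite (_ : _ @^-1` _ = [set w | avoids i (Num.truncn r) (X ^~ w)]).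
  exact: measurable_avoids.
apply/seteqP; split=> w /=; rewrite in_itv/= andbT.
  by rewrite -(hitting_time_gt R); apply: le_lt_trans; rewrite lee_fin.
by rewrite -(hitting_time_ge R); apply: lt_le_trans; rewrite lte_fin.
Qed.

(** Markov's inequality at level m + 1 rather than m, because T_i > m means T_i >= m + 1. *)
Lemma expected_hitting_time_markov x m :
  ((m.+1%:R * survival P i x m)%:E <= expected_hitting_time Pr X x i)%E.
Proof.
have m0 : 0 < m.+1%:R :> R by [].
have := @le_integral_comp_abse _ _ _ (Pr x) _ measurableT _ m.+1%:R id
  (@measurable_id _ _ _) (fun _ => id) (fun _ _ _ _ => id)
  measurable_hitting_time m0.
have absT w : `|hitting_time R i (X ^~ w)|%E = hitting_time R i (X ^~ w).
  by rewrite gee0_abs// (le_trans _ (hitting_time_ge1 R i _))// lee_fin.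
under eq_integral do rewrite absT.
apply: le_trans; rewrite EFinM lee_pmul2l//.
rewrite setTI (_ : [set _ | _] = [set w | avoids i m (X ^~ w)]).
  by rewrite -(avoids_probability (Xchain x)).

by apply: eq_set => w; rewrite absT hitting_time_ge.
Qed.

(* When the maximum is infinite, [fine] turns it into 0 and the bound says
   only that a probability is at most 2. *)
Lemma survival_exponential m :
  survival P i i m <=
    2 * 2 `^ (- (m%:R / (2 * max_hitting_time Pr X i))).
Proof.
set H := max_hitting_time Pr X i.
have [H0|HN0] := eqVneq H 0.
  rewrite H0 mulr0 invr0 mulr0 oppr0 powRr0 mulr1.
  by rewrite (le_trans (survival_le1 Pstoch _ _ _))//; lra.
(* [fine] sends both infinities to 0, so a nonzero [H] is the genuine maximum. *)
have HE x : (expected_hitting_time Pr X x i <= H%:E)%E.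
  rewrite fineK; first exact: (@le_bigmax _ _ _ -oo%E).
  move: HN0; rewrite /H /max_hitting_time.
  by case: (\big[maxe/-oo%E]_(y : S) expected_hitting_time Pr X y i) => //=;
    rewrite eqxx.
have markov x n : n.+1%:R * survival P i x n <= H.
  by rewrite -lee_fin (le_trans (expected_hitting_time_markov _ _)).
have H1 : 1 <= H by have := markov i 0%N; rewrite survival0 mul1r.
have H2 : 0 <= 2 * H by lra.
(* Block length floor(2 H): since L + 1 > 2 H, Markov's inequality at level L + 1 bounds the
   survival of a block by 1/2 from any starting state. *)
set L := Num.truncn (2 * H).
have /andP[L1 L2] := truncn_itv H2; rewrite -/L in L1 L2.
have L_gt0 : (0 < L)%N.
  by rewrite lt0n; apply/eqP => L0; move: L2; rewrite L0; lra.
have half x : survival P i x L <= 2^-1.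
  have L0 : 0 < L.+1%:R :> R by [].
  rewrite -(ler_pM2l L0) (le_trans (markov x L))//; lra.
apply: (@le_trans _ _ (2^-1 ^+ (m %/ L))).
  apply: le_trans (survival_nincr Pstoch _ _ (leq_divM m L)) _.
  by apply: (survival_pow Pstoch) => //; rewrite invr_ge0.
(* Rounding up to m %/ L + 1 blocks covers the incomplete last block; this extra block costs the
   factor 2 in the bound. *)
have mL : m%:R / (2 * H) <= (m %/ L).+1%:R.
  rewrite ler_pdivrMr; last by lra.
  apply: (@le_trans _ _ ((m %/ L).+1%:R * L%:R)); last by rewrite ler_wpM2l.
  by rewrite -natrM ler_nat ltnW// ltn_ceil.
apply: (@le_trans _ _ (2 * 2 `^ (- (m %/ L).+1%:R))); last first.
  by rewrite ler_wpM2l// ler_powR ?lerN2//; lra.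
rewrite powRN powR_mulrn// exprS invfM mulrA divff// mul1r exprVn//.
Qed.

End Tail.

(** * Sample sizes *)

Section RandomIndex.
Variables (R : realType) (I T : finType) (p : T -> R).
Hypotheses (p_ge0 : forall t, 0 <= p t) (p_sum1 : \sum_t p t = 1).
Local Notation cfg := {ffun I -> T}.

(* The event [bad n] concerns fresh coordinates only, so it may be tested at an
   index chosen from the other coordinates as if that index were fixed. *)
Lemma product_mean_random_index (A : pred I) (G : pred cfg) (N : cfg -> nat)
    (bad : nat -> pred cfg) M (c : R) : 0 <= c ->
  (forall F F' : cfg, (forall a, A a -> F a = F' a) -> G F = G F' /\ N F = N F') ->
  (forall n (F F' : cfg), (forall a, ~~ A a -> F a = F' a) -> bad n F = bad n F') ->
  (forall F, G F -> (N F <= M)%N /\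
     product_mean p (fun F' : cfg => (bad (N F) F')%:R) <= c) ->
  product_mean p (fun F : cfg => (G F && bad (N F) F)%:R) <= c.
Proof.
move=> c0 GN badA hc.
pose h (n : 'I_M.+1) (F : cfg) : R := (G F && (N F == n))%:R.
have h_sum F : \sum_n h n F = (G F)%:R.
  rewrite /h; case: (boolP (G F)) => GF /=; last by rewrite big1.
  have NM : (N F < M.+1)%N by have [] := hc F GF.
  rewrite (bigD1 (Ordinal NM))//= eqxx big1 ?addr0// => n.
  by rewrite -val_eqE /= eq_sym => /negbTE ->.
have -> : product_mean p (fun F : cfg => (G F && bad (N F) F)%:R) =
    product_mean p (fun F : cfg => \sum_(n < M.+1) h n F * (bad n F)%:R).
  apply: eq_bigr => F _; congr (_ * _); rewrite /h.
  case: (boolP (G F)) => GF /=; last by rewrite big1// => n _; rewrite mul0r.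
  have NM : (N F < M.+1)%N by have [] := hc F GF.
  rewrite (bigD1 (Ordinal NM))//= eqxx mul1r big1 ?addr0// => n.
  by rewrite -val_eqE /= eq_sym => /negbTE ->; rewrite mul0r.
rewrite product_mean_sum.
apply: (@le_trans _ _ (\sum_(n < M.+1) product_mean p (h n) * c)); last first.
  rewrite -mulr_suml -product_mean_sum.
  rewrite -[leRHS]mul1r ler_wpM2r// -(@product_mean_cst _ I _ _ p_sum1 1).
  by apply: le_product_mean => // F; rewrite h_sum lern1 leq_b1.
apply: ler_sum => n _.
(* A value [n] attained on [G] supplies a configuration certifying the bound for [bad n]; an
   unattained value contributes 0. *)
have [F /andP[GF /eqP NF]|none] := pickP (fun F => G F && (N F == n)); last first.
  rewrite [leLHS](_ : _ = 0).
    by rewrite mulr_ge0// product_mean_ge0// => F.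
  by rewrite /product_mean big1// => F _; rewrite /h none mul0r mulr0.
rewrite (product_mean_indep p_sum1 (A := A)).
- by rewrite ler_wpM2l ?product_mean_ge0//; have [_] := hc F GF; rewrite NF.
- by move=> F1 F2 /GN; rewrite /h => -[-> ->].
- by move=> F1 F2 /badA ->.
Qed.

End RandomIndex.

Section NatCeil.
Variable R : realType.

Lemma nat_ceilE (a : R) : 0 <= a -> ((nat_ceil a)%:R : R) = (Num.ceil a)%:~R.
Proof.
move=> a0; rewrite /nat_ceil natr_absz ger0_norm// ceil_ge0.
by rewrite (lt_le_trans _ a0).
Qed.

Lemma nat_ceil_ge (a : R) : 0 <= a -> a <= (nat_ceil a)%:R.
Proof. by move=> a0; rewrite nat_ceilE ?ceil_ge. Qed.

Lemma le_nat_ceil (a b : R) : 0 <= a -> a <= b -> (nat_ceil a <= nat_ceil b)%N.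
Proof.
move=> a0 ab; rewrite -(ler_nat R) !nat_ceilE//; last exact: le_trans ab.
by rewrite ler_int le_ceil.
Qed.

End NatCeil.

Section SampleMean.
Variable R : realType.

Lemma sample_mean0 (v : nat -> R) : sample_mean 0 v = 0.
Proof. by rewrite /sample_mean big_ord0 mul0r. Qed.

Lemma sample_mean_ge0 n (v : nat -> R) : (forall s, 0 <= v s) -> 0 <= sample_mean n v.
Proof. by move=> v0; rewrite /sample_mean divr_ge0// sumr_ge0. Qed.

Lemma sample_mean_ge1 n (v : nat -> R) : (0 < n)%N -> (forall s, 1 <= v s) ->
  1 <= sample_mean n v.
Proof.
move=> n0 v1; rewrite /sample_mean ler_pdivlMr ?ltr0n// mul1r.
rewrite -[n in leLHS]card_ord -sumr_const.
by apply: ler_sum.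
Qed.

Lemma eq_sample_mean n (v v' : nat -> R) : (forall s, (s < n)%N -> v s = v' s) ->
  sample_mean n v = sample_mean n v'.
Proof. by move=> vv'; congr (_ / _); apply: eq_bigr => s _; rewrite vv'. Qed.

End SampleMean.

Section Sizes.
Variables (R : realType) (S : finType) (i : S) (eps alpha : R).
Hypotheses (eps_gt0 : 0 < eps) (eps_lt1 : eps < 1)
  (alpha_gt0 : 0 < alpha) (alpha_lt1 : alpha < 1).
Implicit Types y : nat -> nat -> nat -> S.

Local Notation N := (sample_size i eps alpha).

Lemma threshold_gt0 k : (0 < threshold k)%N.
Proof. by rewrite expn_gt0. Qed.

Lemma threshold_ge1 k : 1 <= (threshold k)%:R :> R.
Proof. by rewrite ler1n threshold_gt0. Qed.

Lemma ln_threshold_gt0 k : 0 < ln (4 * (threshold k)%:R / alpha).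
Proof.
rewrite ln_gt0// ltr_pdivlMr// mul1r (lt_le_trans alpha_lt1)//.
by move: (threshold k)%:R (threshold_ge1 k) => t; lra.
Qed.

Lemma size_numerator_gt0 k :
  0 < 3 * (1 + eps) * (threshold k)%:R * ln (4 * (threshold k)%:R / alpha).
Proof.
rewrite mulr_gt0 ?ln_threshold_gt0// mulr_gt0 ?ltr0n ?threshold_gt0//.
by rewrite mulr_gt0// addr_gt0.
Qed.

Lemma T_hat_ge0 y k : 0 <= T_hat i eps alpha y k.
Proof.
by apply: sample_mean_ge0 => s; rewrite (le_trans ler01)// sample_length_ge1
  ?threshold_gt0.
Qed.

Lemma T_hat_ge1 y k : (0 < N y k)%N -> 1 <= T_hat i eps alpha y k.
Proof.
by move=> Nk; apply: sample_mean_ge1 => // s; rewrite sample_length_ge1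
  ?threshold_gt0.
Qed.

Lemma F_hat_ge0 y j k : 0 <= F_hat i eps alpha y j k.
Proof. by apply: sample_mean_ge0 => s; exact: sample_visits_ge0. Qed.

Lemma sample_sizeSS y k : N y k.+2 =
  nat_ceil (3 * (1 + eps) * (threshold k.+2)%:R * ln (4 * (threshold k.+2)%:R / alpha)
    / (T_hat i eps alpha y k.+1 * eps ^+ 2)).
Proof. by []. Qed.

(** The first size is deterministic. Later ones depend on the samples only through [T_hat], which is
    at least 1 for a nonempty sample, so the size with [T_hat] replaced by 1 is a bound. *)
Lemma sample_size_bounded k :
  exists M, forall k', (k' <= k)%N -> forall y, (N y k' <= M)%N.
Proof.
elim: k => [|k [M IHM]]; first by exists 0%N => k'; rewrite leqn0 => /eqP ->.
suff [M' hM'] : exists M', forall y, (N y k.+1 <= M')%N.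
  exists (maxn M M') => k'; rewrite leq_eqVlt => /predU1P[-> y|k'k y].
    by rewrite leq_max hM' orbT.
  by rewrite leq_max IHM.
case: k {IHM} => [|k]; first by eexists => y; exact: leqnn.
exists (nat_ceil (3 * (1 + eps) * (threshold k.+2)%:R
    * ln (4 * (threshold k.+2)%:R / alpha) / eps ^+ 2)) => y.
have a0 := ltW (size_numerator_gt0 k.+2); set a := 3 * _ * _ * _ in a0 *.
rewrite sample_sizeSS -/a; apply: le_nat_ceil.
  by rewrite divr_ge0// mulr_ge0 ?T_hat_ge0 ?sqr_ge0.
rewrite invfM mulrCA mulrC ler_piMr ?divr_ge0 ?sqr_ge0//.
(* An empty sample has mean 0, and the inverse of 0 is 0, so the bound persists. *)
have [N0|N0] := posnP (N y k.+1); first by rewrite /T_hat N0 sample_mean0 invr0.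
by rewrite invf_le1 ?T_hat_ge1// (lt_le_trans ltr01)// T_hat_ge1.
Qed.

(** Agreement on a finite window. Thresholds increase, so with [M] bounding the sample sizes it
    contains all data used through iteration [k]. *)
Definition agree k M y y' := forall k' s t, (k' <= k)%N -> (s < M)%N ->
  (t <= threshold k)%N -> y k' s t = y' k' s t.

Lemma leq_threshold k k' : (k <= k')%N -> (threshold k <= threshold k')%N.
Proof. by move=> kk'; rewrite leq_exp2l. Qed.

Lemma eq_T_hat k M y y' k' : agree k M y y' -> (k' <= k)%N -> (N y k' <= M)%N ->
  N y k' = N y' k' -> T_hat i eps alpha y k' = T_hat i eps alpha y' k'.
Proof.
move=> yy' k'k NM NN; rewrite /T_hat -NN; apply: eq_sample_mean => s sN.
apply: eq_sample_length => t tk; apply: yy' => //; first exact: leq_trans NM.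
by apply: leq_trans tk _; exact: leq_threshold.
Qed.

Lemma eq_F_hat k M y y' j k' : agree k M y y' -> (k' <= k)%N -> (N y k' <= M)%N ->
  N y k' = N y' k' -> F_hat i eps alpha y j k' = F_hat i eps alpha y' j k'.
Proof.
move=> yy' k'k NM NN; rewrite /F_hat -NN; apply: eq_sample_mean => s sN.
apply: eq_sample_visits => t tk; apply: yy' => //; first exact: leq_trans NM.
by apply: leq_trans tk _; exact: leq_threshold.
Qed.

(** Sizes are predictable: the window stops at iteration [k] but determines the size of iteration
    [k.+1]. *)
Lemma eq_sample_size k M y y' : agree k M y y' ->
  (forall k', (k' <= k)%N -> forall y, (N y k' <= M)%N) ->
  forall k', (k' <= k.+1)%N -> N y k' = N y' k'.
Proof.
move=> yy' NM; elim=> [//|[//|k'] IHk'] k'k.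
by rewrite !sample_sizeSS (eq_T_hat yy')//; [exact: NM|exact: IHk' (ltnW k'k)].
Qed.

End Sizes.

(** * Concentration over the iterations *)

Section Configurations.
Variables (R : realType) (S : finType) (P : S -> S -> R) (i j : S).
Hypothesis Pstoch : stochastic P.
Variables (eps alpha : R).
Hypotheses (eps_gt0 : 0 < eps) (eps_lt1 : eps < 1)
  (alpha_gt0 : 0 < alpha) (alpha_lt1 : alpha < 1).
Variables (d : measure_display) (W : measurableType d)
  (Q : probability W R) (Y : nat -> nat -> nat -> W -> S).
Hypotheses (Ychain : forall k s, markov_chain_from Q P i (Y k s))
  (Yindep : mutually_independent Q
     (fun ks : nat * nat => process_sigma (Y ks.1 ks.2))).

Let y_ (w : W) : nat -> nat -> nat -> S := fun k s t => Y k s t w.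

(** All paths are recorded up to the largest threshold, so that every coordinate has the same finite
    type and the same law. *)
Definition config (k M : nat) : finType :=
  {ffun 'I_k.+1 * 'I_M.+1 -> {ffun 'I_(threshold k).+1 -> S}}.

Definition config_of k M (y : nat -> nat -> nat -> S) : config k M :=
  [ffun a : 'I_k.+1 * 'I_M.+1 => path_of (threshold k) (y a.1 a.2)].

Definition config_ext k M (F : config k M) : nat -> nat -> nat -> S :=
  fun k' s => path_ext (F (inord k', inord s)).

Lemma agree_config k M y : agree k M.+1 y (config_ext (config_of k M y)).
Proof.
move=> k' s t k'k sM tk.
by rewrite /config_ext ffunE path_ofK//= !inordK.
Qed.

Lemma process_sigma_path k s n f :
  process_sigma (Y k s) ((fun w => path_of n (Y k s ^~ w)) @^-1` [set f]).
Proof.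
have -> : (fun w => path_of n (Y k s ^~ w)) @^-1` [set f] =
    \bigcap_(t in [set` 'I_n.+1]) (Y k s t @^-1` [set f t]).
  apply/seteqP; split=> [w <- t _ /=|w h /=]; first by rewrite ffunE.
  by apply/ffunP => t; rewrite ffunE; exact: h.
pose G := [set A | exists t x, A = Y k s t @^-1` [set x]].
apply: (@fin_bigcap_measurable _ (g_sigma_algebraType G)) => // t _.
by apply: sub_sigma_algebra; exists t, (f t).
Qed.

Lemma config_ofE k M (F : config k M) :
  (fun w => config_of k M (y_ w)) @^-1` [set F] =
  \bigcap_(ks in [set` [seq (val a.1, val a.2) | a <- enum {: 'I_k.+1 * 'I_M.+1}]])
    ((fun w => path_of (threshold k) (Y ks.1 ks.2 ^~ w)) @^-1`
       [set F (inord ks.1, inord ks.2)]).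
Proof.
apply/seteqP; split=> [w <- _ /mapP[a _ ->] /=|w h /=].
  by rewrite ffunE /= !inord_val.
apply/ffunP => a; rewrite ffunE.
have /= := h (val a.1, val a.2); rewrite !inord_val -surjective_pairing; apply.
by apply/mapP; exists a; rewrite ?mem_enum.
Qed.

Lemma measurable_config k M (F : config k M) :
  measurable ((fun w => config_of k M (y_ w)) @^-1` [set F]).
Proof.
rewrite config_ofE; apply: fin_bigcap_measurable => // ks _.
exact: (measurable_path (Ychain ks.1 ks.2)).
Qed.

Lemma config_probability k M (F : config k M) :
  Q ((fun w => config_of k M (y_ w)) @^-1` [set F]) =
  (\prod_a path_law P i (F a))%:E.
Proof.
rewrite config_ofE Yindep.
- rewrite big_map big_enum /= -prodEFin; apply: eq_bigr => a _.
  rewrite (path_probability (Ychain (val a.1) (val a.2))) /= !inord_val.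
  by rewrite -surjective_pairing.
- rewrite map_inj_uniq ?enum_uniq// => -[a1 a2] [b1 b2] /= [].
  by move=> /val_inj -> /val_inj ->.
- by move=> ks _; exact: process_sigma_path.
Qed.

Lemma config_event k M (B : pred (config k M)) :
  Q [set w | B (config_of k M (y_ w))] =
  (product_mean (path_law P i (n := threshold k)) (fun F => (B F)%:R))%:E.
Proof.
rewrite (measure_finite_valued Q (@measurable_config k M)).
under eq_bigr do rewrite config_probability.
rewrite sumEFin big_mkcond /=; congr EFin; apply: eq_bigr => F _.
by case: ifP; rewrite (mulr1, mulr0).
Qed.

Let law k (f : {ffun 'I_(threshold k).+1 -> S}) : R := path_law P i f.
Let law_ge0 k (f : {ffun 'I_(threshold k).+1 -> S}) : 0 <= law f. Proof. exact: path_law_ge0. Qed.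
Let law_sum1 k : \sum_(f : {ffun 'I_(threshold k).+1 -> S}) law f = 1.
Proof. exact: (path_law_sum1 (Ychain 0 0)). Qed.

Definition samples (k M n : nat) : {set 'I_k.+1 * 'I_M.+1} :=
  [set a : 'I_k.+1 * 'I_M.+1 | (a.1 == ord_max) && (a.2 < n)%N].

Lemma sum_samples k M n (F : 'I_k.+1 * 'I_M.+1 -> R) : (n <= M.+1)%N ->
  \sum_(a in samples k M n) F a = \sum_(s < n) F (inord k, inord s).
Proof.
move=> nM.
rewrite (eq_big (fun a : 'I_k.+1 * 'I_M.+1 => (a.1 == ord_max) && (a.2 < n)%N)
  (fun a => F (a.1, a.2))); first last.
- by move=> a _; rewrite -surjective_pairing.
- by move=> a; rewrite inE.
rewrite -(pair_big_dep (fun a1 : 'I_k.+1 => a1 == ord_max) (fun _ (a2 : 'I_M.+1) => (a2 < n)%N)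
  (fun a1 a2 => F (a1, a2))) /= big_pred1_eq.
have -> : inord k = ord_max :> 'I_k.+1 by apply: val_inj; rewrite /= inordK.
rewrite (big_ord_widen _ (fun s => F (ord_max, inord s)) nM).
by apply: eq_bigr => s _; rewrite inord_val.
Qed.

Lemma card_samples k M n : (n <= M.+1)%N -> #|samples k M n|%:R = n%:R :> R.
Proof.
move=> nM; have := sum_samples (k := k) (fun=> 1) nM.
by rewrite !sumr_const card_ord.
Qed.

(** Sum of the upper and lower Chernoff tails, at [x] and [- x]. The scale [tau] may exceed the
    mean, as it does for visit counts. *)
Lemma deviation_probability k M n (v : (nat -> S) -> R) (tau : R) :
  (n <= M.+1)%N -> (forall x, 0 <= v x <= (threshold k)%:R) ->
  let mu := \sum_(f : {ffun 'I_(threshold k).+1 -> S}) law f * v (path_ext f) in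
  mu <= tau ->
  product_mean (@law k) (fun F : config k M =>
    ((eps * tau < `|sample_mean n (fun s => v (config_ext F k s)) - mu|)%R)%:R) <=
  2 * expR (- (n%:R * eps ^+ 2 * tau / (3 * (threshold k)%:R))).
Proof.
move=> nM v01 mu mutau.
pose x : R := 2 / 3 * eps.
have x0 : 0 < x by rewrite /x mulr_gt0.
have xE : `|x| = 2 / 3 * eps by rewrite ger0_norm// ltW.
have xNE : `|- x| = 2 / 3 * eps by rewrite normrN.
have th0 : 0 < (threshold k)%:R :> R by rewrite ltr0n threshold_gt0.
have v01' (f : {ffun 'I_(threshold k).+1 -> S}) :
  0 <= (v \o @path_ext S _) f <= (threshold k)%:R by exact: v01.
have up := chernoff_one_sided (samples k M n) (@law_ge0 k) (@law_sum1 k) th0 v01'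
  mutau (ltW eps_gt0) (ltW eps_lt1) xE.
have dn := chernoff_one_sided (samples k M n) (@law_ge0 k) (@law_sum1 k) th0 v01'
  mutau (ltW eps_gt0) (ltW eps_lt1) xNE.
rewrite /= card_samples// in up dn.
rewrite mulr_natl mulr2n; apply: le_trans (lerD up dn).
rewrite /product_mean -big_split /=; apply: ler_sum => F _.
rewrite -mulrDr; apply: ler_wpM2l; first by apply: prodr_ge0 => a _; exact: law_ge0.
rewrite sum_samples// -/mu normrN [`|x|](ger0_norm (ltW x0)).
set m := sample_mean _ _.
have -> : \sum_(s < n) v (path_ext (F (inord k, inord s))) = n%:R * m.
  rewrite /m /sample_mean; have [->|n0] := eqVneq n 0%N.
    by rewrite big_ord0 mul0r.
  by rewrite mulrCA divff ?mulr1// pnatr_eq0.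
rewrite -natrD ler_nat; case: (boolP (eps * tau < _)) => //= dev.
have nx0 : 0 <= n%:R * x by rewrite mulr_ge0// ltW.
set up' := n%:R * _ <= x * _; set dn' := n%:R * _ <= - x * _.
suff /orP[->|->] : up' || dn' by rewrite ?leq_addr ?leq_addl.
rewrite /up' /dn' !mulNr -!mulrBr !mulrA; have [m_mu|m_mu] := leP mu m.
  move: dev; rewrite ger0_norm ?subr_ge0// => /ltW /(ler_wpM2l nx0).
  by rewrite [x * n%:R]mulrC => h; apply/orP; left; rewrite -!mulrA in h *.
move: dev; rewrite ltr0_norm ?subr_lt0// => /ltW /(ler_wpM2l nx0).
by rewrite mulrN [x * n%:R]mulrC => h; apply/orP; right; rewrite -!mulrA in h *.
Qed.

Local Notation T_ k := (mean_length P i i (threshold k)).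
Local Notation F_ k := (mean_visits P i i j (threshold k)).

(** Both errors use the scale [T_ k], as [ratio_estimate] requires. The size [n] is a parameter, so
    for fixed [n] the event concerns iteration [k] alone. *)
Definition deviates k n (y : nat -> nat -> nat -> S) : bool :=
  (eps * T_ k < `|sample_mean n (fun s => sample_length R i (threshold k) (y k s)) - T_ k|)
  || (eps * T_ k < `|sample_mean n (fun s => sample_visits R i j (threshold k) (y k s)) - F_ k|).

(* Iteration 0 is a dummy, so it counts as accurate. *)
Definition accurate k y : bool :=
  (k == 0%N) || ~~ deviates k (sample_size i eps alpha y k) y.

Lemma deviates_probability k M n : (n <= M.+1)%N ->
  product_mean (@law k) (fun F : config k M => (deviates k n (config_ext F))%:R) <=
  4 * expR (- (n%:R * eps ^+ 2 * T_ k / (3 * (threshold k)%:R))).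
Proof.
move=> nM; set b := expR _.
have len := @deviation_probability k M n (sample_length R i (threshold k)) (T_ k) nM.
have vis := @deviation_probability k M n (sample_visits R i j (threshold k)) (T_ k) nM.
rewrite /= (path_mean_length (Ychain 0 0)) in len.
rewrite /= (path_mean_visits (Ychain 0 0)) in vis.
have {}len := len _ (lexx _).
have {}vis := vis _ (mean_visits_le Pstoch _ _ _).
rewrite (_ : 4 * b = 2 * b + 2 * b); last by rewrite -mulrDl -natrD.
apply: le_trans (lerD (len _) (vis _)).
- rewrite /product_mean -big_split /=; apply: ler_sum => F _.
  rewrite -mulrDr; apply: ler_wpM2l; first by apply: prodr_ge0 => a _; exact: law_ge0.
  by rewrite -natrD ler_nat /deviates; case: (_ < _); case: (_ < _).
- move=> x; rewrite sample_length_le andbT (le_trans ler01)// sample_length_ge1//.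
  exact: threshold_gt0.
- by move=> x; rewrite sample_visits_ge0 (le_trans (sample_visits_le_length _ _ _ _ _))//
    sample_length_le.
Qed.

(** Bounds a failure of iteration k + 1 after an accurate iteration k. The generic value is four
    tails of alpha / (4 theta) each, with theta = 2 ^ (k + 1); at k = 0 it comes from the prescribed
    first size. *)
Definition failure_bound k : R :=
  if k == 0%N then 4 * expR (- ((1 + eps) * ln (8 / alpha))) else alpha / 2 ^+ k.+1.

Lemma failure_bound_ge0 k : 0 <= failure_bound k.
Proof.
rewrite /failure_bound; case: ifP => _; first by rewrite mulr_ge0 ?expR_ge0.
by rewrite divr_ge0 ?(ltW alpha_gt0)// exprn_ge0.
Qed.

Lemma accurate_T_hat k y : accurate k.+1 y ->
  `|T_hat i eps alpha y k.+1 - T_ k.+1| <= eps * T_ k.+1.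
Proof. by rewrite /accurate /= negb_or -!leNgt => /andP[]. Qed.

Lemma accurate_F_hat k y : accurate k.+1 y ->
  `|F_hat i eps alpha y j k.+1 - F_ k.+1| <= eps * T_ k.+1.
Proof. by rewrite /accurate /= negb_or -!leNgt => /andP[]. Qed.

Lemma mean_length_gt0 k : 0 < T_ k.
Proof. by rewrite (lt_le_trans ltr01)// mean_length_ge1// threshold_gt0. Qed.

Lemma accurate_T_hat_gt0 k y : accurate k.+1 y -> 0 < T_hat i eps alpha y k.+1.
Proof.
move=> /accurate_T_hat /ler_normlP[h _].
have : 0 < (1 - eps) * T_ k.+1 by rewrite mulr_gt0 ?mean_length_gt0 ?subr_gt0.
move: (T_ k.+1) (T_hat _ _ _ _ _) h => t u; lra.
Qed.

(** Accuracy gives T_hat <= (1 + eps) T for iteration k, and T increases with k; the factor 1 + eps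
    in the size formula compensates, leaving an exponent of at least ln(4 theta / alpha). *)
Lemma sample_size_deviation k y : accurate k y ->
  4 * expR (- ((sample_size i eps alpha y k.+1)%:R * eps ^+ 2 * T_ k.+1 /
     (3 * (threshold k.+1)%:R))) <= failure_bound k.
Proof.
have e2 : 0 < eps ^+ 2 by rewrite exprn_gt0.
have T1 k' : 1 <= T_ k' by rewrite mean_length_ge1// threshold_gt0.
have th0 k' : 0 < (threshold k')%:R :> R by rewrite ltr0n threshold_gt0.
have e1 : 0 < 1 + eps by rewrite addr_gt0.
(* For the first iteration the threshold 2 and the mean length, at least 1, turn the constant 6 into
   the exponent (1 + eps) ln(8 / alpha). *)
rewrite /failure_bound; case: k => [_|k acc].
  rewrite eqxx ler_pM2l// ler_expR lerN2.
  have ln0 : 0 < ln (8 / alpha).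
    by rewrite ln_gt0// ltr_pdivlMr// mul1r (lt_trans alpha_lt1)// ltr1n.
  rewrite ler_pdivlMr ?mulr_gt0// -[leLHS]mulr1.
  apply: ler_pM => //; first by rewrite !mulr_ge0// ltW.
  rewrite -ler_pdivrMr//.
  apply: le_trans (nat_ceil_ge _); last by rewrite divr_ge0 ?ltW// !mulr_gt0.
  rewrite ler_pM2r ?invr_gt0// (_ : (threshold 1)%:R = 2)//; lra.
rewrite sample_sizeSS [X in _ <= X]/=.
have That_gt0 := accurate_T_hat_gt0 acc.
have /accurate_T_hat /ler_normlP[_ That_le] := acc.
have TT : T_ k.+1 <= T_ k.+2 by rewrite mean_length_le// leq_threshold.
set That := T_hat _ _ _ _ _ in That_gt0 That_le *; clearbody That.
have ln0 := ln_threshold_gt0 alpha_gt0 alpha_lt1 k.+2.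
set L := ln _ in ln0 *; set theta := (threshold k.+2)%:R in L ln0 *.
have theta0 : 0 < theta := th0 k.+2.
have -> : alpha / 2 ^+ k.+2 = 4 * expR (- L).
  rewrite /L expRN lnK; last by rewrite posrE divr_gt0// mulr_gt0.
  rewrite invf_div mulrCA; congr (_ * _).
  by rewrite [(4 * _)^-1]invfM mulrA divff// mul1r /theta natrX.
rewrite ler_pM2l// ler_expR lerN2 ler_pdivlMr; last by rewrite mulr_gt0.
set a := nat_ceil _.
have a_ge : 3 * (1 + eps) * theta * L / (That * eps ^+ 2) <= a%:R.
  apply/nat_ceil_ge/divr_ge0; first exact: ltW (size_numerator_gt0 _ _ _ _).
  by apply: mulr_ge0; exact: ltW.
have TT' : That <= (1 + eps) * T_ k.+2.
  have : (1 + eps) * T_ k.+1 <= (1 + eps) * T_ k.+2 by rewrite ler_pM2l.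
  by move: (T_ k.+1) (T_ k.+2) That_le => t t'; lra.
rewrite ler_pdivrMr ?mulr_gt0// in a_ge.
have a0 : 0 <= a%:R * eps ^+ 2 by rewrite mulr_ge0// ltW.
rewrite -(ler_pM2l e1); have := ler_wpM2l a0 TT'.
move: a_ge; move: (T_ k.+2) (eps ^+ 2) (a%:R) => t e a'; lra.
Qed.

(** Only the preceding iteration has to be accurate: the bound on the next deviation probability
    rests on it alone. *)
Definition first_failure k (y : nat -> nat -> nat -> S) : bool :=
  accurate k y && ~~ accurate k.+1 y.

Lemma accurate_eq k M y y' : (forall k', (k' <= k)%N ->
    forall y, (sample_size i eps alpha y k' <= M)%N) ->
  agree k M y y' -> forall k', (k' <= k)%N -> accurate k' y = accurate k' y'.
Proof.
move=> NM yy' [//|k'] k'k; rewrite /accurate /deviates.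
have NN := eq_sample_size yy' NM (leqW k'k).
have := eq_T_hat yy' k'k (NM _ k'k y) NN; rewrite /T_hat => ->.
by have := eq_F_hat j yy' k'k (NM _ k'k y) NN; rewrite /F_hat => ->.
Qed.

Lemma measurable_of_config k M (B : set (nat -> nat -> nat -> S)) :
  (forall y y', agree k M.+1 y y' -> B y -> B y') ->
  measurable [set w | B (y_ w)].
Proof.
move=> BM.
rewrite (_ : [set w | _] = (fun w => config_of k M (y_ w)) @^-1`
  [set F | B (config_ext F)]).
  by apply: measurable_finite_valued => F; exact: measurable_config.
apply/seteqP; split=> w /=; apply: BM; first exact: agree_config.
by move=> k' s t *; symmetry; exact: (agree_config (k := k) (M := M)).
Qed.

Lemma first_failure_probability k :
  (Q [set w | first_failure k (y_ w)] <= (failure_bound k)%:E)%E.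
Proof.
have [M NM] := sample_size_bounded i eps_gt0 alpha_gt0 alpha_lt1 k.+1.
have NM' k' : (k' <= k.+1)%N -> forall y : nat -> nat -> nat -> S,
  (sample_size i eps alpha y k' <= M.+1)%N by move=> /NM h y; exact: leqW.
have -> : [set w | first_failure k (y_ w)] =
    [set w | first_failure k (config_ext (config_of k.+1 M (y_ w)))].
  apply: eq_set => w; rewrite /first_failure.
  have ac := accurate_eq NM' (@agree_config k.+1 M (y_ w)).
  by rewrite !ac.
rewrite (config_event (fun F : config k.+1 M => first_failure k (config_ext F))).
rewrite lee_fin.
pose N (F : config k.+1 M) := sample_size i eps alpha (config_ext F) k.+1.
have -> : product_mean (path_law P i (n := threshold k.+1))
      (fun F : config k.+1 M => (first_failure k (config_ext F))%:R) =
    product_mean (@law k.+1) (fun F : config k.+1 M =>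
      (accurate k (config_ext F) && deviates k.+1 (N F) (config_ext F))%:R).
  by apply: eq_bigr => F _; rewrite /first_failure [accurate k.+1 _]orFb negbK.
(* The coordinates with [a.1 != ord_max] are the earlier iterations: they determine the accuracy of
   iteration [k] and the next size, while the deviation sees only the last iteration. *)
apply: (@product_mean_random_index R _ _ _ (@law_ge0 k.+1) (@law_sum1 k.+1)
  (fun a => a.1 != ord_max) (fun F => accurate k (config_ext F)) N
  (fun n F => deviates k.+1 n (config_ext F)) M).
- exact: failure_bound_ge0.
- move=> F F' FF'.
  have yy' : agree k M.+1 (config_ext F) (config_ext F').
    move=> k' s t k'k sM _; rewrite /config_ext FF'//.
    by rewrite -val_eqE /= inordK ?ltn_eqF// ltnS leqW.
  have NMk k' : (k' <= k)%N -> forall y : nat -> nat -> nat -> S,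
    (sample_size i eps alpha y k' <= M.+1)%N by move=> /leqW /NM'.
  by rewrite (accurate_eq NMk yy')// /N (eq_sample_size yy' NMk).
- move=> n F F' FF'; rewrite /deviates.
  have -> : config_ext F k.+1 = config_ext F' k.+1; last by [].
  apply/funext => s; rewrite /config_ext FF'//.
  by rewrite negbK -val_eqE /= inordK.
- move=> F acc; split; first exact: NM.
  apply: le_trans (sample_size_deviation acc); apply: deviates_probability.
  by apply: leqW; exact: NM.
Qed.

Lemma sum_failure_bound n :
  \sum_(k < n.+1) failure_bound k =
  4 * expR (- ((1 + eps) * ln (8 / alpha))) + alpha / 2 - alpha / 2 ^+ n.+1.
Proof.
elim: n => [|n IHn]; first by rewrite big_ord1 /failure_bound /= expr1; lra.
rewrite big_ord_recr IHn /failure_bound /= [2 ^+ n.+2]exprS.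
have : 2 ^+ n.+1 != 0 :> R by rewrite expf_neq0.
by move: (2 ^+ n.+1) => u u0; field.
Qed.

Lemma failure_bound_head : 4 * expR (- ((1 + eps) * ln (8 / alpha))) < alpha / 2.
Proof.
have ln0 : 0 < ln (8 / alpha).
  by rewrite ln_gt0// ltr_pdivlMr// mul1r (lt_trans alpha_lt1)// ltr1n.
have -> : alpha / 2 = 4 * expR (- ln (8 / alpha)).
  rewrite expRN lnK ?posrE ?divr_gt0// invf_div; lra.
by rewrite ltr_pM2l// ltr_expR ltrN2 ltr_pMl// ltrDl.
Qed.

Lemma measurable_accurate k : measurable [set w | accurate k (y_ w)].
Proof.
have [M NM] := sample_size_bounded i eps_gt0 alpha_gt0 alpha_lt1 k.
apply: (@measurable_of_config k M (fun y => accurate k y)) => y y' yy'.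
by rewrite (accurate_eq _ yy')// => k' /NM h z; exact: leqW.
Qed.

(* The sum of the failure bounds stays below alpha strictly, thanks to the
   factor 1 + eps in the size of the first sample. *)
Lemma accurate_probability :
  ((1 - alpha)%:E < Q [set w | forall k, accurate k (y_ w)])%E.
Proof.
set A := [set w | _].
have mA : measurable A.
  rewrite (_ : A = \bigcap_k [set w | accurate k (y_ w)]).
    by apply: bigcapT_measurable => k; exact: measurable_accurate.
  by apply/seteqP; split=> w h k => [_|]; exact: h.
pose B := alpha / 2 + 4 * expR (- ((1 + eps) * ln (8 / alpha))).
have mF k : measurable [set w | first_failure k (y_ w)].
  rewrite (_ : [set w | _] = [set w | accurate k (y_ w)] `\`
    [set w | accurate k.+1 (y_ w)]).
    by apply: measurableD; exact: measurable_accurate.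
  by apply/seteqP; split=> w /= => [/andP[? /negP]|[a /negP b]] //; rewrite /first_failure a.
have QC : (Q (~` A) <= B%:E)%E.
  apply: le_trans (@measure_sigma_subadditive _ _ _ Q (~` A)
    (fun k => [set w | first_failure k (y_ w)]) mF _ _) _.
  - exact: measurableC.
  (* Iteration 0 is accurate, so without any switch from accurate to inaccurate all iterations are
     accurate by induction. *)
  - move=> w /= /existsNP[k nk]; apply: contrapT => nF; apply: nk.
    elim: k => [//|k IHk]; apply: contrapT => /negP nk.
    by apply: nF; exists k => //=; rewrite /first_failure IHk.
  apply: lime_le; first by apply: is_cvg_nneseries => n _ _; exact: measure_ge0.
  apply: nearW => -[|n]; rewrite big_mkord.
    by rewrite big_ord0 lee_fin addr_ge0 ?divr_ge0 ?mulr_ge0 ?expR_ge0// ltW.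
  apply: (@le_trans _ _ (\sum_(k < n.+1) (failure_bound k)%:E)%E).
    by apply: lee_sum => k _; exact: first_failure_probability.
  rewrite sumEFin lee_fin sum_failure_bound /B addrC [X in _ <= X]addrC.
  by rewrite addrC lerBlDr lerDl divr_ge0 ?exprn_ge0// ltW.
have QA : (Q A = 1 - Q (~` A))%E by rewrite -{1}(setCK A) probability_setC//; exact: measurableC.
rewrite QA; apply: (@lt_le_trans _ _ (1 - B%:E)%E); last exact: leeB.
by rewrite -EFinB lte_fin ltrD2l ltrN2 /B; have := failure_bound_head; lra.
Qed.

End Configurations.

(** * The error bounds on the event that every iteration is accurate *)

Theorem theorem5 (R : realType) (S : finType)
  (P : S -> S -> R) (pi : S -> R)
  (Pstoch : stochastic P) (Pirr : irreducible P) (pistat : stationary P pi)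
  (d : measure_display) (W : measurableType d)
  (Pr : S -> probability W R) (X : nat -> W -> S)
  (Xchain : forall x, markov_chain_from (Pr x) P x X)
  (i j : S) (jNi : j != i)
  (eps alpha : R)
  (eps_gt0 : 0 < eps) (eps_lt1 : eps < 1)
  (alpha_gt0 : 0 < alpha) (alpha_lt1 : alpha < 1)
  (d' : measure_display) (W' : measurableType d')
  (Q : probability W' R) (Y : nat -> nat -> nat -> W' -> S)
  (Ychain : forall k s, markov_chain_from Q P i (Y k s))
  (Yindep : mutually_independent Q
     (fun ks : nat * nat => process_sigma (Y ks.1 ks.2))) :
  ((1 - alpha)%:E <
   Q [set w | (forall k, (1 <= k)%N ->
       let y := fun k s t => Y k s t w in
       let theta : R := (threshold k)%:R in
       let pit := pi_tilde i eps alpha y j k in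
       let pih := pi_hat i eps alpha y k in
       let H := max_hitting_time Pr X i in
       `|pit - pi j| <= 2 * (1 + eps) * tail_prob Pr X i (threshold k)
                          * Zmax P pi j * pih + eps * pit + eps
       /\
       2 * (1 + eps) * tail_prob Pr X i (threshold k)
         * Zmax P pi j * pih + eps * pit + eps
       <= 4 * (1 + eps) * 2 `^ (- (theta / (2 * H)))
            * Zmax P pi j * pih + eps * pit + eps)%R])%E.
Proof.
have acc_prob := accurate_probability j Pstoch eps_gt0 eps_lt1 alpha_gt0 alpha_lt1
  Ychain Yindep.
apply: (lt_le_trans acc_prob); apply: le_measure; rewrite ?inE.
- rewrite (_ : [set w | _] = \bigcap_k [set w | accurate P i j eps alpha k
      (fun k s t => Y k s t w)]).
    apply: bigcapT_measurable => k.
    exact: (measurable_accurate j eps_gt0 alpha_gt0 alpha_lt1 Ychain).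
  by apply/seteqP; split=> w h k => [_|]; exact: h.
- set bounds := fun (k : nat) (y : nat -> nat -> nat -> S) =>
    let theta : R := (threshold k)%:R in
    let pit := pi_tilde i eps alpha y j k in
    let pih := pi_hat i eps alpha y k in
    let H := max_hitting_time Pr X i in
    `|pit - pi j| <= 2 * (1 + eps) * tail_prob Pr X i (threshold k)
                       * Zmax P pi j * pih + eps * pit + eps /\
    2 * (1 + eps) * tail_prob Pr X i (threshold k)
      * Zmax P pi j * pih + eps * pit + eps
    <= 4 * (1 + eps) * 2 `^ (- (theta / (2 * H)))
         * Zmax P pi j * pih + eps * pit + eps.
  (* For each [k] the bounds depend on a finite window of the samples only, so the event is a
     countable intersection of measurable ones. *)
  rewrite (_ : [set w | _] = \bigcap_(k in [set k | (1 <= k)%N])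
     [set w | bounds k (fun k s t => Y k s t w)]).
    apply: bigcap_measurable; first by exists 1%N.
    move=> k _.
    have [M NM] := sample_size_bounded i eps_gt0 alpha_gt0 alpha_lt1 k.
    apply: (measurable_of_config (k := k) (M := M) Ychain) => y y' yy'.
    have NM' k' : (k' <= k)%N -> forall y : nat -> nat -> nat -> S,
      (sample_size i eps alpha y k' <= M.+1)%N by move=> /NM h z; exact: leqW.
    have NN := eq_sample_size yy' NM' (leqnSn k).
    rewrite /bounds /pi_tilde /pi_hat.
    rewrite (eq_T_hat yy' (leqnn k) (NM' k (leqnn k) y) NN).
    by rewrite (eq_F_hat j yy' (leqnn k) (NM' k (leqnn k) y) NN).
  by apply/seteqP; split=> w h k; exact: h.
move=> w /= acc [//|k] _; rewrite (tail_probE Xchain) /pi_tilde /pi_hat.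
have {}acc := acc k.+1.
have [pi_ge0 _ _] := pistat.
have e1 : 0 < 1 + eps by rewrite addr_gt0.
have That_gt0 := accurate_T_hat_gt0 Pstoch eps_lt1 acc.
split.
  (* Regrouping makes the product of the tail probability and [Zmax] play the role of [b] in
     [ratio_estimate]. *)
  rewrite -(mulrA (2 * (1 + eps))); apply: ratio_estimate => //.
  - exact: F_hat_ge0.
  - exact: accurate_T_hat acc.
  - exact: accurate_F_hat acc.
  - by rewrite mulrA; exact: visits_bias.
(* Once the common terms cancel, the exponential tail bound remains; its factor 2 turns 2 (1 + eps)
   into 4 (1 + eps). *)
rewrite !lerD2r; apply: ler_wpM2r; first by rewrite invr_ge0 ltW.
apply: ler_wpM2r; first exact: Zmax_ge0.
have := survival_exponential Pstoch Xchain i (threshold k.+1).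
move=> /(ler_wpM2l (ltW e1)); move: (_ `^ _) (survival _ _ _ _) => a b; lra.
Qed.
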